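(* Let $(\sigma,V^{(1)},V^{(2)})$ be an isometric covariant representation of the product system $\mathbb E$ over $\mathbb N_0^2$ on a Hilbert space $\mathcal H$. If the joint defect operator $C=C(\sigma,V^{(1)},V^{(2)})$ is compact, then $(\sigma_2,F^{(2)})$ is Fredholm and $$\operatorname{ind}(\sigma_2,F^{(2)})=\dim\mathcal E_{-1}(C)-\dim\mathcal E_1(C).$$
   Context: All $*$-homomorphisms and representations are nondegenerate. A $C^*$-correspondence over a $C^*$-algebra $\mathcal A$ is a Hilbert $\mathcal A$-module $F$ with a left action of $\mathcal A$ given by a $*$-homomorphism into the adjointable operators on $F$. Tensor products are interior tensor products, and for a representation $\sigma$ of $\mathcal A$ on a Hilbert space $\mathcal H$, $F\otimes\mathcal H=F\otimes_\sigma\mathcal H$ has inner product $\langle\xi_1\otimes h_1,\xi_2\otimes h_2\rangle=\langle h_1,\sigma(\langle\xi_1,\xi_2\rangle)h_2\rangle$. A (completely bounded) covariant representation of $F$ on $\mathcal H$ is a pair $(\sigma,V)$ with $\sigma:\mathcal A\to B(\mathcal H)$ a representation and $V:F\to B(\mathcal H)$ linear, completely bounded, with $V(b\xi a)=\sigma(b)V(\xi)\sigma(a)$; put $\widetilde V:F\otimes\mathcal H\to\mathcal H$, $\widetilde V(\xi\otimes h)=V(\xi)h$. It is isometric if $V(\eta)^*V(\xi)=\sigma(\langle\eta,\xi\rangle)$ (equivalently $\widetilde V$ is an isometry). It is Fredholm if the range of $\widetilde V$ is closed and the kernels $N(\widetilde V),N(\widetilde V^* )$ are finite-dimensional; then $\operatorname{ind}(\sigma,V)=\dim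 N(\widetilde V)-\dim N(\widetilde V^* )$. A product system $\mathbb E$ over $\mathbb N_0^2$ consists of $C^*$-correspondences $E_1,E_2$ over $\mathcal A$ and a unitary isomorphism $t_{2,1}:E_2\otimes E_1\to E_1\otimes E_2$; $t_{1,2}=t_{2,1}^{-1}$, $E:=E_1\otimes E_2$. A covariant representation of $\mathbb E$ on $\mathcal H$ is a triple $(\sigma,V^{(1)},V^{(2)})$ where each $(\sigma,V^{(i)})$ is a covariant representation of $E_i$ and $\widetilde V^{(1)}(I_{E_1}\otimes\widetilde V^{(2)})=\widetilde V^{(2)}(I_{E_2}\otimes\widetilde V^{(1)})(t_{1,2}\otimes I_{\mathcal H})$; it is isometric if both $(\sigma,V^{(i)})$ are. Put $\widetilde V:=\widetilde V^{(1)}(I_{E_1}\otimes\widetilde V^{(2)}):E\otimes\mathcal H\to\mathcal H$. Joint defect operator: $C(\sigma,V^{(1)},V^{(2)})=I-\widetilde V^{(1)}\widetilde V^{(1)*}-\widetilde V^{(2)}\widetilde V^{(2)*}+\widetilde V\widetilde V^*$. $\mathcal E_\lambda(C)=\ker(C-\lambda I)$. Let $\mathcal W_1=\mathcal H\ominus\widetilde V^{(1)}(E_1\otimes\mathcal H)$ (which is $\sigma$-invariant). The Fringe operator $\widetilde F^{(2)}:E_2\otimes\mathcal W_1\to\mathcal W_1$ is $\widetilde F^{(2)}=P_{\mathcal W_1}\widetilde V^{(2)}|_{E_2\otimes\mathcal W_1}$, with $P_{\mathcal W_1}$ the orthogonal projection onto $\mathcal W_1$; it defines the covariant representation $(\sigma_2,F^{(2)})$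 of $E_2$ on $\mathcal W_1$, where $\sigma_2=\sigma|_{\mathcal W_1}$. *)

(* Defs.v *)
From HB Require Import structures.
From mathcomp Require Import all_boot all_order all_algebra.
From mathcomp Require Import complex.
From mathcomp Require Import all_classical all_reals all_analysis.

Set Implicit Arguments.
Unset Strict Implicit.
Unset Printing Implicit Defensive.

Import Order.TTheory GRing.Theory Num.Theory.
Import numFieldNormedType.Exports.

Local Open Scope classical_set_scope.
Local Open Scope ring_scope.

Section LinearAlgebra.
Variables (R : realType).

Definition lspan (V : lmodType R[i]) (S : set V) : set V :=
  [set x | exists (n : nat) (c : 'I_n -> R[i]) (v : 'I_n -> V),
     (forall k, S (v k)) /\ x = \sum_(k < n) c k *: v k].

Definition is_basis (V : lmodType R[i]) (S : set V) (n : nat) (b : 'I_n -> V) :=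
  (forall c : 'I_n -> R[i], \sum_(k < n) c k *: b k = 0 -> forall k, c k = 0) /\
  S = lspan (range b).

Definition finite_dim (V : lmodType R[i]) (S : set V) : Prop :=
  exists (n : nat) (b : 'I_n -> V), is_basis S b.

(* The value is 0 when S is not a finite-dimensional subspace. *)
Definition dimension (V : lmodType R[i]) (S : set V) : nat :=
  xget 0%N [set n | exists b : 'I_n -> V, is_basis S b].

Definition total_set (V : normedModType R[i]) (S : set V) : Prop :=
  closure (lspan S) = [set: V].

Definition bounded_op (V W : normedModType R[i]) (T : V -> W) : Prop :=
  linear T /\ continuous T.

Definition compact_op (V W : normedModType R[i]) (T : V -> W) : Prop :=
  precompact (T @` [set x | `|x| <= 1]).

Definition op_ker (V W : lmodType R[i]) (T : V -> W) : set V :=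
  [set x | T x = 0].

Definition op_eigenspace (V : lmodType R[i]) (T : V -> V) (l : R[i]) : set V :=
  op_ker (fun x => T x - l *: x).

Definition bilinear_op (U V W : lmodType R[i]) (f : U -> V -> W) : Prop :=
  (forall u, linear (f u)) /\ (forall v, linear (f ^~ v)).

End LinearAlgebra.

(* Inner products are linear in the second variable. *)
HB.mixin Record isHilbert (R : realType) H & CompleteNormedModule R[i] H := {
  ip : H -> H -> R[i];
  ip_linear : forall x, scalar (ip x);
  ip_conj : forall x y, ip y x = (ip x y)^*;
  ip_norm : forall x, ip x x = `|x| ^+ 2 }.

#[short(type="hilbertType")]
HB.structure Definition Hilbert (R : realType) :=
  {H of CompleteNormedModule R[i] H & isHilbert R H}.

Section CauchySchwarz.
Variables (R : realType) (H : hilbertType R).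
Implicit Types x y : H.

Lemma ip0r x : ip x 0 = 0.
Proof. by have := ip_linear x (-1) 0 0; rewrite scaler0 addr0 mulN1r addNr. Qed.

Lemma ip_cauchy_schwarz x y : `|ip x y| <= `|x| * `|y|.
Proof.
have [->|x0] := eqVneq x 0.
  by rewrite ip_conj ip0r rmorph0 normr0 mulr_ge0.
have n0 : 0 < `|x| ^+ 2 by rewrite exprn_gt0 ?normr_gt0.
have zl z u v (c : R[i]) : ip (c *: u + v) z = c^* * ip u z + ip v z.
  by rewrite ip_conj ip_linear rmorphD rmorphM /= -!ip_conj.
pose c := - (ip x y / `|x| ^+ 2).
have : 0 <= ip (c *: x + y) (c *: x + y) by rewrite ip_norm exprn_ge0.
set a := ip x y; pose d := a^* / `|x| ^+ 2.
have n2 : (`|x| ^+ 2)^* = `|x| ^+ 2 :> R[i] by rewrite -ip_norm -ip_conj.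
have cE : c^* = - d by rewrite /c rmorphN/= rmorphM/= fmorphV/= n2.
rewrite ip_linear !zl !ip_norm -/a (ip_conj x y) -/a cE {1}/d.
clearbody c; rewrite mulNr divfK ?gt_eqF// addNr mulr0 add0r mulNr => h.
rewrite -(@ler_pXn2r _ 2) ?nnegrE ?mulr_ge0// exprMn.
have {h}: `|a| ^+ 2 / `|x| ^+ 2 <= `|y| ^+ 2.
  by rewrite -subr_ge0 addrC normCK (mulrC a) mulrAC.
by rewrite ler_pdivrMr// mulrC.
Qed.
End CauchySchwarz.

(* Not necessarily unital. *)
HB.mixin Record isCstar (R : realType) A & CompleteNormedModule R[i] A := {
  cmul : A -> A -> A;
  star : A -> A;
  cmulA : associative cmul;
  cmul_bilinear : bilinear_op cmul;
  cmul_norm : forall a b, `|cmul a b| <= `|a| * `|b|;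
  starK : involutive star;
  starM : forall a b, star (cmul a b) = cmul (star b) (star a);
  star_conjlinear : forall (c : R[i]) a b, star (c *: a + b) = c^* *: star a + star b;
  star_norm : forall a, `|cmul (star a) a| = `|a| ^+ 2 }.

#[short(type="cstarType")]
HB.structure Definition Cstar (R : realType) :=
  {A of CompleteNormedModule R[i] A & isCstar R A}.

(* Hilbert A-modules; their norm is |<x, x>|^(1/2). *)
HB.mixin Record isHilbertModule (R : realType) (A : cstarType R) F
    & CompleteNormedModule R[i] F := {
  ract : F -> A -> F;
  rip : F -> F -> A;
  ract_bilinear : bilinear_op ract;
  ractM : forall x a b, ract x (cmul a b) = ract (ract x a) b;
  rip_linear : forall x, linear (rip x);
  rip_ract : forall x y a, rip x (ract y a) = cmul (rip x y) a;
  rip_star : forall x y, rip y x = star (rip x y);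
  rip_ge0 : forall x, exists a : A, rip x x = cmul (star a) a;
  rip_norm : forall x, `|x| ^+ 2 = `|rip x x| }.

#[short(type="hilbertModType")]
HB.structure Definition HilbertModule (R : realType) (A : cstarType R) :=
  {F of CompleteNormedModule R[i] F & isHilbertModule R A F}.

HB.mixin Record isCorrespondence (R : realType) (A : cstarType R) F
    & HilbertModule R A F := {
  lact : A -> F -> F;
  lact_bilinear : bilinear_op lact;
  lactM : forall a b x, lact (cmul a b) x = lact a (lact b x);
  lact_adj : forall a (x y : F),
    rip (lact a x) y = rip x (lact (star a) y) :> A;
  lact_nondegenerate : total_set [set z | exists a x, z = lact a x] }.

#[short(type="corrType")]
HB.structure Definition Correspondence (R : realType) (A : cstarType R) :=
  {F of HilbertModule R A F & isCorrespondence R A F}.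

Section Adjoint.
Variables (R : realType).

Definition adj (H K : hilbertType R) (T : H -> K) : K -> H :=
  xget (fun=> 0) [set S : K -> H | forall x y, ip (T x) y = ip x (S y)].

Definition fredholm_op (H K : hilbertType R) (T : H -> K) : Prop :=
  [/\ closed (range T), finite_dim (op_ker T) & finite_dim (op_ker (adj T))].

Definition op_index (H K : hilbertType R) (T : H -> K) : int :=
  (dimension (op_ker T))%:Z - (dimension (op_ker (adj T)))%:Z.

End Adjoint.

Record closed_subspace (R : realType) (H : hilbertType R) := ClosedSubspace {
  cs_set :> set H;
  cs0 : cs_set 0;
  cs_lin : forall (c : R[i]) x y, cs_set x -> cs_set y -> cs_set (c *: x + y);
  cs_closed : closed cs_set }.

Definition cs_mem (R : realType) (H : hilbertType R) (W : closed_subspace H)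
  : {pred H} := fun x => x \in (W : set H).

Record cs_type (R : realType) (H : hilbertType R) (W : closed_subspace H) :=
  CsType { cs_val : H; _ : cs_mem W cs_val }.

HB.instance Definition _ (R : realType) (H : hilbertType R)
  (W : closed_subspace H) := [isSub for @cs_val R H W].
HB.instance Definition _ (R : realType) (H : hilbertType R)
  (W : closed_subspace H) := [Choice of cs_type W by <:].

Lemma cs_submod (R : realType) (H : hilbertType R) (W : closed_subspace H) :
  GRing.submod_closed (cs_mem W).
Proof.
split; first exact/mem_set/cs0.
by move=> c x y /set_mem Wx /set_mem Wy; exact/mem_set/cs_lin.
Qed.

HB.instance Definition _ (R : realType) (H : hilbertType R)
    (W : closed_subspace H) :=
  GRing.isSubmodClosed.Build R[i] H (cs_mem W) (cs_submod W).
HB.instance Definition _ (R : realType) (H : hilbertType R)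
  (W : closed_subspace H) := [SubChoice_isSubLmodule of cs_type W by <:].

Section ClosedSubspaceHilbert.
Variables (R : realType) (H : hilbertType R) (W : closed_subspace H).
Implicit Types x y : cs_type W.

Definition cs_norm x : R[i] := `|val x|.

Lemma cs_normD x y : cs_norm (x + y) <= cs_norm x + cs_norm y.
Proof. exact: ler_normD. Qed.

Lemma cs_normZ (c : R[i]) x : cs_norm (c *: x) = `|c| * cs_norm x.
Proof. exact: normrZ. Qed.

Lemma cs_norm0 x : cs_norm x = 0 -> x = 0.
Proof. by move=> /normr0_eq0 x0; exact/val_inj. Qed.

End ClosedSubspaceHilbert.

HB.instance Definition _ (R : realType) (H : hilbertType R)
    (W : closed_subspace H) :=
  Lmodule_isNormed.Build R[i] (cs_type W)
    (@cs_normD R H W) (@cs_normZ R H W) (@cs_norm0 R H W).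

Lemma cs_complete (R : realType) (H : hilbertType R) (W : closed_subspace H)
  (F : set_system (cs_type W)) : ProperFilter F -> cauchy F -> cvg F.
Proof.
move=> FF /cauchyP Fc.
pose G : set_system H := val @ F.
have GF : ProperFilter G by exact: fmap_proper_filter.
have Gc : cauchy G.
  apply/cauchyP => e e0; have [x Fx] := Fc e e0.
  exists (val x); rewrite /G /= /fmap/=; apply: filterS Fx => y /=.
  by rewrite -!ball_normE.
have /cauchy_cvg Gl := Gc.
have Wl : (W : set H) (lim G).
  have cW : closed (W : set H) by exact: cs_closed.
  have nW : \forall x \near F, (W : set H) (val x).
    by apply: nearW => x; exact: (set_mem (valP x)).
  exact: (@closed_cvg (cs_type W) H F FF val (cs_set W) cW nW (lim G) Gl).
have Ml : cs_mem W (lim G) by exact/mem_set.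
apply/cvg_ex; exists (Sub (lim G) Ml : cs_type W).
apply/cvgrPdist_lt => e e0.
have := Gl; move=> /cvgrPdist_lt /(_ e e0).
exact.
Qed.

HB.instance Definition _ (R : realType) (H : hilbertType R)
    (W : closed_subspace H) :=
  Uniform_isComplete.Build (cs_type W) (@cs_complete R H W).

Section ClosedSubspaceIp.
Variables (R : realType) (H : hilbertType R) (W : closed_subspace H).
Implicit Types x y : cs_type W.

Definition cs_ip x y : R[i] := ip (val x) (val y).

Lemma cs_ip_linear x : scalar (cs_ip x).
Proof. by move=> c y z; rewrite /cs_ip ip_linear. Qed.

Lemma cs_ip_conj x y : cs_ip y x = (cs_ip x y)^*.
Proof. exact: ip_conj. Qed.

Lemma cs_ip_norm x : cs_ip x x = `|x| ^+ 2.
Proof. exact: ip_norm. Qed.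

End ClosedSubspaceIp.

HB.instance Definition _ (R : realType) (H : hilbertType R)
    (W : closed_subspace H) :=
  isHilbert.Build R (cs_type W)
    (@cs_ip_linear R H W) (@cs_ip_conj R H W) (@cs_ip_norm R H W).

Section Ortho.
Variables (R : realType) (H : hilbertType R) (S : set H).

Definition ortho_set : set H := [set x | forall y, S y -> ip y x = 0].

Lemma ortho_set0 : ortho_set 0.
Proof.
by move=> y _; have := ip_linear y (-1) 0 0; rewrite scaler0 addr0 mulN1r addNr.
Qed.

Lemma ortho_set_lin (c : R[i]) x y :
  ortho_set x -> ortho_set y -> ortho_set (c *: x + y).
Proof. by move=> Sx Sy z Sz; rewrite ip_linear Sx// Sy// mulr0 addr0. Qed.

Lemma ortho_set_closed : closed ortho_set.
Proof.
move=> x clx y Sy; apply/eqP; rewrite -normr_le0.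
apply/ler_addgt0Pl => e e0; rewrite addr0.
have d0 : 0 < e / (`|y| + 1) by rewrite divr_gt0 ?ltr_wpDl.
have [z [Oz]] := clx _ (nbhsx_ballx x _ d0).
rewrite -ball_normE /= => xz.
have -> : ip y x = ip y (x - z).
  by rewrite addrC -scaleN1r ip_linear Oz// mulr0 add0r.
rewrite (le_trans (ip_cauchy_schwarz _ _))//.
rewrite (@le_trans _ _ ((`|y| + 1) * `|x - z|)) ?ler_wpM2r ?lerDl//.
by rewrite mulrC -ler_pdivlMr ?ltr_wpDl// ltW.
Qed.

Definition ortho : closed_subspace H :=
  ClosedSubspace ortho_set0 ortho_set_lin ortho_set_closed.

End Ortho.

Section Projection.
Variables (R : realType) (H : hilbertType R) (W : closed_subspace H).

Definition proj (x : H) : cs_type W :=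
  xget 0 [set p : cs_type W | forall w : cs_type W, ip (val w) (x - val p) = 0].

(* For W invariant under f, the restriction of f to W. *)
Definition restrict_op (f : H -> H) (w : cs_type W) : cs_type W :=
  insubd 0 (f (val w)).

End Projection.

(* An interior tensor product is determined, up to a unique unitary compatible
   with elementary tensors, by the inner products and totality of the latter.
   Any such model is allowed. *)
Record htensor (R : realType) (A : cstarType R) (F : corrType A)
    (H : hilbertType R) (sigma : A -> H -> H) := HTensor {
  ht_space :> hilbertType R;
  ht : F -> H -> ht_space;
  ht_bilinear : bilinear_op ht;
  ht_balanced : forall x a h, ht (ract x a) h = ht x (sigma a h);
  ht_ip : forall x1 x2 h1 h2,
    ip (ht x1 h1) (ht x2 h2) = ip h1 (sigma (rip x1 x2) h2);
  ht_total : total_set [set z | exists x h, z = ht x h] }.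

Record ctensor (R : realType) (A : cstarType R) (E F : corrType A) := CTensor {
  ct_space :> corrType A;
  ct : E -> F -> ct_space;
  ct_bilinear : bilinear_op ct;
  ct_balanced : forall x a y, ct (ract x a) y = ct x (lact a y);
  ct_rip : forall x1 x2 y1 y2,
    rip (ct x1 y1) (ct x2 y2) = rip y1 (lact (rip x1 x2) y2) :> A;
  ct_ract : forall x y a, ract (ct x y) a = ct x (ract y a);
  ct_lact : forall a x y, lact a (ct x y) = ct (lact a x) y;
  ct_total : total_set [set z | exists x y, z = ct x y] }.

Record corr_unitary (R : realType) (A : cstarType R) (E F : corrType A)
    (t : E -> F) : Prop := CorrUnitary {
  cu_linear : linear t;
  cu_lact : forall a x, t (lact a x) = lact a (t x);
  cu_ract : forall x a, t (ract x a) = ract (t x) a;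
  cu_rip : forall x y, rip (t x) (t y) = rip x y :> A;
  cu_surj : forall z, exists x, t x = z }.

Record product_system (R : realType) (A : cstarType R) := ProductSystem {
  ps1 : corrType A;
  ps2 : corrType A;
  ps12 : ctensor ps1 ps2;
  ps21 : ctensor ps2 ps1;
  t21 : ps21 -> ps12;
  t12 : ps12 -> ps21;
  t21_unitary : corr_unitary t21;
  t21K : cancel t21 t12;
  t12K : cancel t12 t21 }.

Section Representations.
Variables (R : realType) (A : cstarType R) (H : hilbertType R).

Record representation (sigma : A -> H -> H) : Prop := Representation {
  rep_bounded : forall a, bounded_op (sigma a);
  rep_linear : forall h, linear (sigma ^~ h);
  rep_mul : forall a b h, sigma (cmul a b) h = sigma a (sigma b h);
  rep_star : forall a h k, ip (sigma a h) k = ip h (sigma (star a) k);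
  rep_nondegenerate : total_set [set z | exists a h, z = sigma a h] }.

Variable F : corrType A.

(* The matrix (x k l) in M_n(F) has norm at most r, M_n(F) being normed as a
   space of operators from A^n to F^n (the corner of the linking algebra). *)
Definition mx_norm_le (n : nat) (x : 'I_n -> 'I_n -> F) (r : R[i]) : Prop :=
  forall a : 'I_n -> A,
    let y k := \sum_(l < n) ract (x k l) (a l) in
    `|\sum_(k < n) rip (y k) (y k) : A| <=
      r ^+ 2 * `|\sum_(l < n) cmul (star (a l)) (a l)|.

Definition completely_bounded (V : F -> H -> H) : Prop :=
  exists2 c : R[i], 0 <= c &
    forall (n : nat) (x : 'I_n -> 'I_n -> F) (r : R[i]),
      0 <= r -> mx_norm_le x r -> forall h : 'I_n -> H,
      \sum_(k < n) `|\sum_(l < n) V (x k l) (h l)| ^+ 2 <=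
        (c * r) ^+ 2 * \sum_(l < n) `|h l| ^+ 2.

Record covariant_rep (sigma : A -> H -> H) (V : F -> H -> H) : Prop :=
    CovariantRep {
  cov_rep : representation sigma;
  cov_bounded : forall x, bounded_op (V x);
  cov_linear : forall h, linear (V ^~ h);
  cov_cb : completely_bounded V;
  cov_covariant : forall b x a h,
    V (lact b (ract x a)) h = sigma b (V x (sigma a h)) }.

Definition isometric_rep (sigma : A -> H -> H) (V : F -> H -> H) : Prop :=
  forall x y h, adj (V y) (V x h) = sigma (rip y x) h.

Variables (sigma : A -> H -> H) (T : htensor F sigma).

(* The bounded operator with prescribed values on elementary tensors. *)
Definition ht_lift (K : hilbertType R) (f : F -> H -> K) : T -> K :=
  xget (fun=> 0) [set S : T -> K | bounded_op S /\
                                   forall x h, S (ht T x h) = f x h].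

Definition tilde (V : F -> H -> H) : T -> H := ht_lift V.

Definition fredholm_rep (V : F -> H -> H) : Prop :=
  covariant_rep sigma V /\ fredholm_op (tilde V).

Definition rep_index (V : F -> H -> H) : int := op_index (tilde V).

End Representations.

Section TensorOperators.
Variables (R : realType) (A : cstarType R) (H : hilbertType R).
Variables (sigma : A -> H -> H).

(* The bounded operator I_E (x) S, after the identification of (E (x) F) (x) H with
   E (x) (F (x) H). *)
Definition id_tens (E F : corrType A) (EF : ctensor E F)
    (TEF : htensor EF sigma) (TF : htensor F sigma) (TE : htensor E sigma)
    (S : TF -> H) : TEF -> TE :=
  xget (fun=> 0) [set Q : TEF -> TE | bounded_op Q /\ forall x y h,
    Q (ht TEF (ct EF x y) h) = ht TE x (S (ht TF y h))].

Definition tens_id (E F : corrType A) (TE : htensor E sigma)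
    (TF : htensor F sigma) (t : E -> F) : TE -> TF :=
  ht_lift (fun x h => ht TF (t x) h).

End TensorOperators.

Arguments id_tens {R A H sigma E F EF} TEF {TF} TE S _.
Arguments tens_id {R A H sigma E F} TE TF t _.

Record ps_htensor (R : realType) (A : cstarType R) (E : product_system A)
    (H : hilbertType R) (sigma : A -> H -> H) := PsHTensor {
  pt1 : htensor (ps1 E) sigma;
  pt2 : htensor (ps2 E) sigma;
  pt12 : htensor (ps12 E) sigma;
  pt21 : htensor (ps21 E) sigma }.

Section ProductSystemRepresentations.
Variables (R : realType) (A : cstarType R) (E : product_system A).
Variables (H : hilbertType R) (sigma : A -> H -> H) (T : ps_htensor E sigma).
Variables (V1 : ps1 E -> H -> H) (V2 : ps2 E -> H -> H).

Definition tilde1 : pt1 T -> H := tilde V1.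
Definition tilde2 : pt2 T -> H := tilde V2.
Definition tilde12 : pt12 T -> H :=
  tilde1 \o id_tens (pt12 T) (pt1 T) tilde2.
Definition tilde21 : pt21 T -> H :=
  tilde2 \o id_tens (pt21 T) (pt2 T) tilde1.

Record ps_rep : Prop := PsRep {
  ps_rep1 : covariant_rep sigma V1;
  ps_rep2 : covariant_rep sigma V2;
  ps_rep_comm : tilde12 = tilde21 \o tens_id (pt12 T) (pt21 T) (@t12 _ _ E) }.

Definition isometric_ps_rep : Prop :=
  [/\ ps_rep, isometric_rep sigma V1 & isometric_rep sigma V2].

Definition joint_defect (h : H) : H :=
  h - tilde1 (adj tilde1 h) - tilde2 (adj tilde2 h) + tilde12 (adj tilde12 h).

Definition wandering1 : closed_subspace H := ortho (range tilde1).

Definition sigma2 (a : A) : cs_type wandering1 -> cs_type wandering1 :=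
  restrict_op (sigma a).

Variable TW : htensor (ps2 E) sigma2.

(* The inclusion of E_2 (x) W_1 into E_2 (x) H. *)
Definition fringe_incl : TW -> pt2 T :=
  ht_lift (fun x (w : cs_type wandering1) => ht (pt2 T) x (val w)).

Definition fringe_op : TW -> cs_type wandering1 :=
  fun z => proj wandering1 (tilde2 (fringe_incl z)).

Definition fringe_rep (x : ps2 E) (w : cs_type wandering1) :
  cs_type wandering1 := fringe_op (ht TW x w).

End ProductSystemRepresentations.

Arguments sigma2 {R A E H sigma} T V1 a _.
Arguments fringe_op {R A E H sigma T V1} V2 TW _.
Arguments fringe_rep {R A E H sigma T V1} V2 TW x w.
Arguments fredholm_rep {R A H F sigma} T V.
Arguments rep_index {R A H F sigma} T V.
Arguments joint_defect {R A E H sigma} T V1 V2 h.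
Arguments isometric_ps_rep {R A E H sigma} T V1 V2.

(* Main.v *)
Require Import Defs.
From mathcomp Require Import all_boot all_order all_algebra.
From mathcomp Require Import complex.
From mathcomp Require Import all_classical all_reals all_analysis.
From mathcomp Require Import ring lra.

(* Let p be the projection onto W_1 and J the isometry V_2 restricted to
   E_2 (x) W_1.  Splitting E_2 (x) H along H = W_1 + V_1(E_1 (x) H) gives
   V_2 V_2^* - V V^* = J J^*, so C = p - J J^* is a difference of projections,
   and the fringe operator is F = p J.  Then E_1(C) = ker F^*, the isometry J
   maps ker F onto E_{-1}(C), and J z + C J z = F z shows that F is Fredholm when
   C is compact.  The splitting needs elementary tensors to be total in
   (E_2 (x) E_1) (x) H, hence that representations are contractive. *)

Set Implicit Arguments.
Unset Strict Implicit.
Unset Printing Implicit Defensive.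

Import Order.TTheory GRing.Theory Num.Theory.
Import numFieldNormedType.Exports.

Local Open Scope ring_scope.

(* MathComp-Analysis has another proj. *)
Local Notation proj := Defs.proj.

(** * Real-valued norms, completeness and bounded operators *)

(** Adjoints, projections and operators on tensor products are all chosen, with a default value when
    nothing qualifies, so each needs an existence proof before it can be used. On tensor products
    this takes no norm estimate: the inclusion of E_2 (x) W_1, V_1, V_2, I (x) V_1 and t (x) I all
    preserve inner products of elementary tensors, and a family with the same Gram matrix as a total
    one is its image under an isometry. Contractivity is not part of the definition of a
    representation, which bounds only each single operator; it is derived from a square root of 1 -
    b for selfadjoint b of norm below 1, and then gives |x (x) h| <= |x| |h|, the continuity in the
    first leg on which totality rests. Compactness serves finite dimension and closed range; the
    index formula comes from the exact identification of both kernels. *)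

Section LinearMaps.
Variables (R : pzRingType) (V W : lmodType R) (T : V -> W).
Hypothesis lT : linear T.

Lemma lin0 : T 0 = 0.
Proof. by have := lT (-1) 0 0; rewrite scaler0 addr0 scaleN1r addNr. Qed.

Lemma linZ c x : T (c *: x) = c *: T x.
Proof. by have := lT c x 0; rewrite !addr0 lin0 addr0. Qed.

Lemma linD x y : T (x + y) = T x + T y.
Proof. by have := lT 1 x y; rewrite !scale1r. Qed.

Lemma linN x : T (- x) = - T x.
Proof. by rewrite -scaleN1r linZ scaleN1r. Qed.

Lemma linB x y : T (x - y) = T x - T y.
Proof. by rewrite linD linN. Qed.

Lemma lin_sum I (r : seq I) (P : pred I) (F : I -> V) :
  T (\sum_(i <- r | P i) F i) = \sum_(i <- r | P i) T (F i).
Proof. by apply: (big_morph T linD lin0). Qed.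

End LinearMaps.

Lemma invS_small (R : realType) (e : R) : 0 < e ->
  exists N, forall n, (N <= n)%N -> n.+1%:R^-1 < e.
Proof.
move=> e0; exists (Num.bound e^-1) => n Nn; rewrite invf_plt ?posrE //.
have /archi_boundP : 0 <= e^-1 by rewrite invr_ge0 ltW.
by move=> /lt_le_trans; apply; rewrite ler_nat leqW.
Qed.

Section RealNorm.
Variables (R : realType) (V : normedModType R[i]).
Implicit Types x y : V.

(* The norm of a complex normed space takes values in R[i]; this is its real
   version, on which lra and nra are available. *)
Definition nrm x : R := complex.Re `|x|.

Lemma nrmE x : `|x| = (nrm x)%:C%C.
Proof. by rewrite /nrm RRe_real. Qed.

Lemma nrm_ge0 x : 0 <= nrm x.
Proof. by rewrite -lecR -nrmE normr_ge0. Qed.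

Lemma nrm0 : nrm 0 = 0.
Proof. by rewrite /nrm normr0. Qed.

Lemma nrm0_eq0 x : nrm x = 0 -> x = 0.
Proof. by move=> x0; apply: normr0_eq0; rewrite nrmE x0. Qed.

Lemma nrmN x : nrm (- x) = nrm x.
Proof. by rewrite /nrm normrN. Qed.

Lemma nrmD x y : nrm (x + y) <= nrm x + nrm y.
Proof. by rewrite -lecR rmorphD /= -!nrmE ler_normD. Qed.

Lemma nrmB x y : nrm (x - y) = nrm (y - x).
Proof. by rewrite -nrmN opprB. Qed.

Lemma nrmDB x y z : nrm (x - z) <= nrm (x - y) + nrm (y - z).
Proof. by have := nrmD (x - y) (y - z); rewrite addrA subrK. Qed.

Lemma nrmZ (c : R) x : nrm (c%:C%C *: x) = `|c| * nrm x.
Proof.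
apply: (@complexI R); rewrite rmorphM /= -!nrmE normrZ; congr (_ * _).
by rewrite normc_def /= expr0n addr0 sqrtr_sqr.
Qed.

Lemma nrmZC (c : R[i]) x : nrm (c *: x) = complex.Re `|c| * nrm x.
Proof.
by rewrite [LHS]/nrm normrZ nrmE; case: `|c| => a b; rewrite /= mulr0 subr0.
Qed.

Lemma nrm_eq0_lt x : (forall e, 0 < e -> nrm x < e) -> x = 0.
Proof.
move=> h; apply: nrm0_eq0; apply/eqP; rewrite eq_le nrm_ge0 andbT.
by apply/ler_addgt0Pl => e e0; rewrite addr0 ltW ?h.
Qed.

Lemma posC (e : R[i]) : 0 < e -> exists2 r : R, 0 < r & e = r%:C%C.
Proof.
move=> e0; have er := gtr0_real e0.
by exists (complex.Re e); [rewrite -ltcR RRe_real | rewrite RRe_real].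
Qed.

Lemma closureP (S : set V) x :
  closure S x <-> (forall e, 0 < e -> exists2 s, S s & nrm (x - s) < e).
Proof.
split=> [cx e e0|h B].
  have e0' : 0 < e%:C%C :> R[i] by rewrite ltcR.
  have [z [Sz]] := cx _ (nbhsx_ballx x _ e0').
  by rewrite -ball_normE /= nrmE ltcR => xz; exists z.
move=> /nbhs_ballP[d d0 sB].
have [r r0 dE] := posC d0.
have [s Ss xs] := h r r0; exists s; split=> //; apply: sB.
by rewrite -ball_normE /= nrmE dE ltcR.
Qed.

Lemma closedP (S : set V) :
  closed S <->
  (forall x, (forall e, 0 < e -> exists2 s, S s & nrm (x - s) < e) -> S x).
Proof. by split=> cS x; [move=> /closureP/cS | move=> /closureP/cS]. Qed.

End RealNorm.

Section Complete.
Variables (R : realType) (V : completeNormedModType R[i]).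

Lemma nrm_cauchy_cvg (u : nat -> V) :
  (forall e, 0 < e -> exists N, forall m n, (N <= m)%N -> (N <= n)%N ->
    nrm (u m - u n) < e) ->
  exists l, forall e, 0 < e -> exists N, forall n, (N <= n)%N ->
    nrm (u n - l) < e.
Proof.
move=> uc.
have Fc : cauchy (u @ \oo)%classic.
  apply/cauchyP => e /posC[r r0 ->].
  have [N hN] := uc r r0.
  exists (u N); exists N => // n /= Nn.
  by rewrite -ball_normE /= nrmE ltcR hN.
have FF : ProperFilter (u @ \oo)%classic by exact: fmap_proper_filter.
have /cvg_ex[l ul] := @cauchy_cvg _ _ FF Fc.
exists l => e e0.
have e0' : 0 < e%:C%C :> R[i] by rewrite ltcR.
have /cvgrPdist_lt /(_ _ e0') [N _ hN] := ul.
by exists N => n /hN /=; rewrite nrmE ltcR nrmB.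
Qed.

End Complete.

Section BoundedOp.
Variables (R : realType) (V W : normedModType R[i]) (T : V -> W).

Lemma bounded_opP : bounded_op T <->
  linear T /\ exists2 M : R, 0 < M & forall x, nrm (T x) <= M * nrm x.
Proof.
split=> [[lT cT]|[lT [M M0 hM]]]; split=> //.
  have e0 : 0 < 1%:C%C :> R[i] by rewrite ltcR.
  have /cvgrPdist_lt /(_ _ e0) := cT 0.
  move=> /nbhs_ballP[d /posC[r r0 ->]] hd.
  have {}hd x : nrm x < r -> nrm (T x) < 1.
    move=> xr; have := hd x; rewrite -ball_normE /= (lin0 lT) !sub0r !normrN.
    by rewrite !nrmE !ltcR; exact.
  (* Only the open ball of radius [r] is controlled, so [x] is rescaled to norm [r / 2]. *)
  exists (2 / r) => [|x]; first by rewrite divr_gt0.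
  have [->|x0] := eqVneq x 0; first by rewrite (lin0 lT) !nrm0 mulr0.
  have nx0 : 0 < nrm x.
    rewrite lt_neqAle nrm_ge0 andbT eq_sym; apply: contraNneq x0.
    by move=> /nrm0_eq0 ->.
  have t0 : 0 < r / (2 * nrm x) by rewrite divr_gt0 // mulr_gt0.
  have := hd ((r / (2 * nrm x))%:C%C *: x).
  rewrite (linZ lT) !nrmZ gtr0_norm //.
  have -> : r / (2 * nrm x) * nrm x = r / 2 by field; rewrite gt_eqF.
  have -> : r / 2 < r by lra.
  move=> /(_ isT); rewrite -ltr_pdivlMl // => /ltW /le_trans; apply.
  by rewrite mulr1 invf_div mulrAC.
move=> x; apply/cvgrPdist_lt => e /posC[r r0 ->].
apply/nbhs_ballP; exists (r / M)%:C%C; first by rewrite /= ltcR divr_gt0.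
move=> y; rewrite -ball_normE /= !nrmE !ltcR => xy.
rewrite -(linB lT).
by rewrite (le_lt_trans (hM _)) // mulrC -ltr_pdivlMr.
Qed.

End BoundedOp.

Section ClosedImage.
Variables (R : realType).

(** The lower bound makes preimages of an approximating sequence Cauchy, and the closed set [S]
    contains their limit. It serves for isometries and for the fringe operator off its kernel. *)
Lemma closed_image (V : completeNormedModType R[i]) (W : normedModType R[i])
    (T : V -> W) (S : set V) (M : R) :
  bounded_op T -> closed S -> 0 < M ->
  (forall x y, S x -> S y -> nrm (x - y) <= M * nrm (T x - T y)) ->
  closed (T @` S)%classic.
Proof.
move=> /bounded_opP[lT [N N0 hN]] /closedP cS M0 hM; apply/closedP => y hy.
have /choice[u hu] (n : nat) : exists x, S x /\ nrm (y - T x) < n.+1%:R^-1.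
  have n0 : 0 < n.+1%:R^-1 :> R by rewrite invr_gt0.
  by have [_ [x Sx <-] yx] := hy _ n0; exists x.
have [l hl] : exists l, forall e, 0 < e -> exists N, forall n, (N <= n)%N ->
    nrm (u n - l) < e.
  apply: nrm_cauchy_cvg => e e0.
  have [k hk] := invS_small (divr_gt0 e0 (mulr_gt0 M0 (ltr0Sn _ 1))).
  exists k => m n /hk hm /hk hn.
  apply: (le_lt_trans (hM _ _ (hu m).1 (hu n).1)).
  rewrite mulrC -ltr_pdivlMr //; apply: (le_lt_trans (nrmDB _ y _)).
  rewrite [nrm (_ - y)]nrmB.
  have -> : e / M = e / (M * 2) + e / (M * 2) by field; rewrite gt_eqF.
  by apply: ltrD; [exact: lt_trans (hu m).2 hm | exact: lt_trans (hu n).2 hn].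
have Sl : S l.
  by apply: cS => e /hl[k hk]; exists (u k); [exact: (hu k).1 | rewrite nrmB hk].
exists l => //; apply/eqP; rewrite -subr_eq0; apply/eqP/nrm_eq0_lt => e e0.
have e2 : 0 < e / 2 by rewrite divr_gt0.
have [k1 h1] := hl _ (divr_gt0 e2 N0); have [k2 h2] := invS_small e2.
pose n := maxn k1 k2.
apply: (le_lt_trans (nrmDB _ (T (u n)) _)); rewrite [e]splitr; apply: ltrD.
  rewrite -(linB lT) (le_lt_trans (hN _)) // mulrC -ltr_pdivlMr //.
  by rewrite nrmB h1 // leq_maxl.
by rewrite nrmB (lt_trans (hu n).2) // h2 // leq_maxr.
Qed.

End ClosedImage.

(** * Inner products and orthogonal projections *)

Section InnerProduct.
Variables (R : realType) (H : hilbertType R).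
Implicit Types x y z : H.

Lemma ipDr x y z : ip x (y + z) = ip x y + ip x z.
Proof. by have := ip_linear x 1 y z; rewrite scale1r mul1r. Qed.

Lemma ipZr x c y : ip x (c *: y) = c * ip x y.
Proof. by have := ip_linear x c y 0; rewrite !addr0 ip0r addr0. Qed.

Lemma ipNr x y : ip x (- y) = - ip x y.
Proof. by rewrite -scaleN1r ipZr mulN1r. Qed.

Lemma ipBr x y z : ip x (y - z) = ip x y - ip x z.
Proof. by rewrite ipDr ipNr. Qed.

Lemma ip_sumr x I (r : seq I) (P : pred I) (F : I -> H) :
  ip x (\sum_(i <- r | P i) F i) = \sum_(i <- r | P i) ip x (F i).
Proof. by apply: (big_morph (ip x) (ipDr x) (ip0r x)). Qed.

Lemma ipDl x y z : ip (x + y) z = ip x z + ip y z.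
Proof. by rewrite ip_conj ipDr rmorphD /= -!ip_conj. Qed.

Lemma ipZl c x y : ip (c *: x) y = c^* * ip x y.
Proof. by rewrite ip_conj ipZr rmorphM /= -!ip_conj. Qed.

Lemma ip0l x : ip 0 x = 0.
Proof. by rewrite ip_conj ip0r rmorph0. Qed.

Lemma ipC0 x y : ip x y = 0 -> ip y x = 0.
Proof. by rewrite (ip_conj x y) => ->; rewrite rmorph0. Qed.

Lemma ipxx x : ip x x = (nrm x ^+ 2)%:C%C.
Proof. by rewrite ip_norm nrmE rmorphXn. Qed.

Lemma Re_ip_le x y : `|complex.Re (ip x y)| <= nrm x * nrm y.
Proof.
rewrite -lecR rmorphM /= -!nrmE.
exact: le_trans (normc_ge_Re _) (ip_cauchy_schwarz _ _).
Qed.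

Lemma Re_ip_sym x y : complex.Re (ip y x) = complex.Re (ip x y).
Proof. by rewrite ip_conj; case: (ip x y). Qed.

Lemma nrm_sqrD x y :
  nrm (x + y) ^+ 2 = nrm x ^+ 2 + 2 * complex.Re (ip x y) + nrm y ^+ 2.
Proof.
have -> : nrm (x + y) ^+ 2 = complex.Re (ip (x + y) (x + y)) by rewrite ipxx.
rewrite ipDl !ipDr !raddfD /= !ipxx /= (Re_ip_sym x y); ring.
Qed.

Lemma nrm_sqrB x y :
  nrm (x - y) ^+ 2 = nrm x ^+ 2 - 2 * complex.Re (ip x y) + nrm y ^+ 2.
Proof. by rewrite nrm_sqrD nrmN ipNr raddfN /= mulrN. Qed.

Lemma pythagoras x y : ip x y = 0 -> nrm (x + y) ^+ 2 = nrm x ^+ 2 + nrm y ^+ 2.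
Proof. by move=> xy; rewrite nrm_sqrD xy /= mulr0 addr0. Qed.

Lemma parallelogram x y :
  nrm (x - y) ^+ 2 = 2 * nrm x ^+ 2 + 2 * nrm y ^+ 2 - nrm (x + y) ^+ 2.
Proof. by rewrite nrm_sqrB nrm_sqrD; ring. Qed.

Lemma nrm_sqr_eq0 x : nrm x ^+ 2 = 0 -> x = 0.
Proof. by move/eqP; rewrite sqrf_eq0 => /eqP/nrm0_eq0. Qed.

Lemma ip_eq0 x : (forall y, ip y x = 0) -> x = 0.
Proof. by move=> h; apply: nrm_sqr_eq0; have := h x; rewrite ipxx => -[]. Qed.

Lemma ip_inj x y : (forall z, ip z x = ip z y) -> x = y.
Proof.
move=> h; apply/eqP; rewrite -subr_eq0; apply/eqP/ip_eq0 => z.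
by rewrite ipBr h subrr.
Qed.

Lemma Re_ip_i x y : complex.Re (ip ('i%C *: x) y) = complex.Im (ip x y).
Proof. by rewrite ipZl; case: (ip x y) => a b; simpc. Qed.

(** Norm identities and minimization along real lines see only real parts; replacing [x] by [i x]
    recovers the rest. *)
Lemma ipE x y :
  ip x y = (complex.Re (ip x y) +i* complex.Re (ip ('i%C *: x) y))%C.
Proof. by rewrite Re_ip_i; case: (ip x y). Qed.

End InnerProduct.

Section Total.
Variables (R : realType).

Lemma lspan_sub (V : lmodType R[i]) (S W : set V) :
  W 0 -> (forall c x y, W x -> W y -> W (c *: x + y)) ->
  (S `<=` W)%classic -> (lspan S `<=` W)%classic.
Proof.
move=> W0 Wl SW _ [n [c [v [Sv ->]]]].
elim/big_ind: _ => // [x y Wx Wy|i _]; first by rewrite -[x]scale1r; apply: Wl.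
by rewrite -[_ *: _]addr0; apply: Wl => //; apply: SW.
Qed.

Lemma sub_lspan (V : lmodType R[i]) (S : set V) : (S `<=` lspan S)%classic.
Proof.
move=> x Sx; exists 1%N, (fun=> 1), (fun=> x).
by rewrite big_ord1 scale1r.
Qed.

Lemma lspan_lin (V : lmodType R[i]) (S : set V) c x y :
  lspan S x -> lspan S y -> lspan S (c *: x + y).
Proof.
move=> [m [a [u [Su ->]]]] [n [b [v [Sv ->]]]].
exists (m + n)%N,
  (fun k => match fintype.split k with inl i => c * a i | inr j => b j end),
  (fun k => match fintype.split k with inl i => u i | inr j => v j end).
split=> [k|]; first by case: (fintype.split k).
rewrite big_split_ord /= scaler_sumr; congr (_ + _); apply: eq_bigr => i _.
  by rewrite (unsplitK (inl i)) scalerA.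
by rewrite (unsplitK (inr i)).
Qed.

Lemma lspan0 (V : lmodType R[i]) (S : set V) : lspan S 0.
Proof. by exists 0%N, (fun=> 0), (fun=> 0); rewrite big_ord0; split=> // -[]. Qed.

Lemma op_ker_lin (V W : lmodType R[i]) (T : V -> W) c x y :
  linear T -> op_ker T x -> op_ker T y -> op_ker T (c *: x + y).
Proof.
by rewrite /op_ker /= => lT x0 y0; rewrite lT x0 y0 scaler0 addr0.
Qed.

Lemma bounded_op_comp (U U' U'' : normedModType R[i])
    (f : U' -> U'') (g : U -> U') :
  bounded_op f -> bounded_op g -> bounded_op (f \o g).
Proof.
move=> [lf cf] [lg cg]; split; first by move=> c x y /=; rewrite lg lf.
by move=> x; apply: continuous_comp; [exact: cg | exact: cf].
Qed.

Variables (V : normedModType R[i]) (S : set V).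

Lemma total_setP : total_set S <->
  (forall x e, 0 < e -> exists2 s, lspan S s & nrm (x - s) < e).
Proof.
split=> [tS x|h].
  by apply/closureP; rewrite -/(closure _ x) (tS : closure _ = _).
by apply/seteqP; split=> // x _; apply/closureP/h.
Qed.

(** The density principle behind the extension arguments below: [W] is instantiated with a kernel,
    an orthogonal complement or the preimage of a closed range. *)
Lemma total_closed (W : set V) : total_set S ->
  W 0 -> (forall c x y, W x -> W y -> W (c *: x + y)) -> closed W ->
  (S `<=` W)%classic -> forall x, W x.
Proof.
move=> /total_setP tS W0 Wl /closedP cW SW x; apply: cW => e /(tS x)[s sS xs].
by exists s => //; apply: lspan_sub sS.
Qed.

Lemma closed_ker (W : normedModType R[i]) (T : V -> W) :
  bounded_op T -> closed (op_ker T).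
Proof.
move=> /bounded_opP[lT [M M0 hM]]; apply/closedP => x h.
apply: nrm_eq0_lt => e e0; have [s Ts xs] := h _ (divr_gt0 e0 M0).
have -> : T x = T (x - s) by rewrite (linB lT) [T s]Ts subr0.
by rewrite (le_lt_trans (hM _)) // mulrC -ltr_pdivlMr.
Qed.

Lemma bounded_opB (W : normedModType R[i]) (T T' : V -> W) :
  bounded_op T -> bounded_op T' -> bounded_op (fun x => T x - T' x).
Proof.
move=> [lT cT] [lT' cT']; split.
  by move=> c x y; rewrite lT lT' scalerBr opprD addrACA.
by move=> x; apply: cvgB; [exact: cT | exact: cT'].
Qed.

Lemma bounded_op_ext (W : normedModType R[i]) (T T' : V -> W) :
  total_set S -> bounded_op T -> bounded_op T' ->
  (forall x, S x -> T x = T' x) -> T = T'.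
Proof.
move=> tS bT bT' h; apply/funext => x; apply/eqP; rewrite -subr_eq0; apply/eqP.
have bD := bounded_opB bT bT'.
apply: (total_closed tS (W := op_ker (fun x => T x - T' x))).
- exact: (lin0 bD.1).
- by move=> c y z; exact: op_ker_lin bD.1.
- exact: closed_ker.
- by move=> y /h; rewrite /op_ker /= => ->; rewrite subrr.
Qed.

End Total.

Section Projection.
Variables (R : realType) (H : hilbertType R).

Lemma ortho_total (S : set H) x :
  total_set S -> (forall s, S s -> ip s x = 0) -> x = 0.
Proof.
move=> tS h; apply: ip_eq0 => y; apply: ipC0.
apply: (total_closed tS (W := ortho_set [set x]%classic)).
- exact: ortho_set0.
- exact: ortho_set_lin.
- exact: ortho_set_closed.
- by move=> s /h sx _ ->; apply: ipC0.
- by [].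
Qed.

(** First-order condition at a minimum. The test point is [a / (b + 1)], where the shift by 1 covers
    [b = 0]. *)
Lemma quadratic_bound (a b : R) :
  0 <= b -> (forall t, 2 * t * a <= t ^+ 2 * b) -> a = 0.
Proof.
move=> b0 h; apply/eqP; rewrite -sqrf_eq0 eq_le sqr_ge0 andbT.
have := h (a / (b + 1)); have b1 : 0 < b + 1 by lra.
rewrite -(ler_pM2r (exprn_gt0 2 b1)).
have -> : 2 * (a / (b + 1)) * a * (b + 1) ^+ 2 = 2 * a ^+ 2 * (b + 1).
  by field; rewrite gt_eqF.
have -> : (a / (b + 1)) ^+ 2 * b * (b + 1) ^+ 2 = a ^+ 2 * b.
  by field; rewrite gt_eqF.
have := sqr_ge0 a; nra.
Qed.

Variable W : closed_subspace H.

Lemma cs_scale c x : cs_set W x -> cs_set W (c *: x).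
Proof. by move=> Wx; rewrite -[_ *: _]addr0; apply: cs_lin => //; exact: cs0. Qed.

Lemma cs_add x y : cs_set W x -> cs_set W y -> cs_set W (x + y).
Proof. by move=> Wx Wy; rewrite -[x]scale1r; apply: cs_lin. Qed.

Lemma projection_theorem x :
  exists2 p, cs_set W p & forall w, cs_set W w -> ip w (x - p) = 0.
Proof.
pose D := [set nrm (x - w) ^+ 2 | w in (W : set H)]%classic.
have iD : has_inf D.
  split; first by exists (nrm (x - 0) ^+ 2), 0 => //; exact: cs0.
  by exists 0 => _ [w _ <-]; exact: sqr_ge0.
have dD w : cs_set W w -> inf D <= nrm (x - w) ^+ 2.
  by move=> Ww; apply: ge_inf; [exact: iD.2 | exists w].
have /choice[u hu] (n : nat) :
    exists w, cs_set W w /\ nrm (x - w) ^+ 2 < inf D + n.+1%:R^-1.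
  have n0 : 0 < n.+1%:R^-1 :> R by rewrite invr_gt0.
  by have [_ [w Ww <-] hw] := inf_adherent n0 iD; exists w.
have [l hl] : exists l, forall e, 0 < e -> exists N, forall n, (N <= n)%N ->
    nrm (u n - l) < e.
  apply: nrm_cauchy_cvg => e e0.
  (* The midpoint of [u m] and [u n] lies in [W], so the parallelogram law bounds
     [nrm (u m - u n) ^+ 2] by twice the sum of the two excesses over [inf D], each below
     [e ^+ 2 / 4]. *)
  have [N hN] := invS_small (divr_gt0 (exprn_gt0 2 e0) (ltr0Sn _ 3)).
  exists N => m n /hN hm /hN hn.
  rewrite -(@ltr_pXn2r _ 2) ?nnegrE ?nrm_ge0 ?ltW //.
  have -> : u m - u n = (x - u n) - (x - u m).
    by rewrite opprB [RHS]addrC addrA subrK.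
  rewrite parallelogram.
  have -> : nrm (x - u n + (x - u m)) ^+ 2 =
      4 * nrm (x - (2^-1 : R)%:C%C *: (u n + u m)) ^+ 2.
    have -> : x - u n + (x - u m) =
        (2 : R)%:C%C *: (x - (2^-1 : R)%:C%C *: (u n + u m)).
      rewrite scalerBr scalerA -rmorphM /= divff // scale1r.
      by rewrite rmorphMn /= rmorph1 scaler_nat mulr2n addrACA opprD.
    by rewrite nrmZ exprMn normr_nat; congr (_ * _); ring.
  have := dD _ (cs_scale (2^-1 : R)%:C%C (cs_add (hu n).1 (hu m).1)).
  have := (hu n).2; have := (hu m).2; move: hm hn.
  move: (m.+1%:R^-1) (n.+1%:R^-1) (nrm _ ^+ 2) (nrm _ ^+ 2) (nrm _ ^+ 2) => *.
  lra.
have Wl : cs_set W l.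
  apply: (proj1 (closedP _) (@cs_closed _ _ W)) => e /hl[N hN].
  by exists (u N); [exact: (hu N).1 | rewrite nrmB hN].
have lmin : nrm (x - l) ^+ 2 <= inf D.
  apply/ler_addgt0Pr => e e0.
  (* [M] exceeds [2 * nrm (x - l)], so the cross term in the square of [nrm (x - l) - nrm (u n - l)]
     stays below [e / 2]; the other half of [e] pays for the excess of [u n]. *)
  pose M := 2 * nrm (x - l) + 1.
  have M0 : 0 < M by rewrite /M; have := nrm_ge0 (x - l); lra.
  have e3 : 0 < Num.min 1 (e / (2 * M)).
    by rewrite lt_min ltr01 divr_gt0 // mulr_gt0.
  have [N1 h1] := hl _ e3.
  have [N2 h2] := invS_small (divr_gt0 e0 (ltr0Sn _ 1)).
  pose n := maxn N1 N2.
  have := h1 n (leq_maxl _ _); rewrite lt_min => /andP[a1 a2].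
  have a3 := h2 n (leq_maxr _ _).
  have := (hu n).2 => a4.
  have a5 := nrmDB x (u n) l.
  have a6 : nrm (u n - l) * (2 * M) < e by rewrite -ltr_pdivlMr // mulr_gt0.
  have := nrm_ge0 (x - u n); have := nrm_ge0 (u n - l); have := nrm_ge0 (x - l).
  move: a1 a3 a4 a5 a6; rewrite /M.
  set a := nrm (x - l); set b := nrm (x - u n); set c := nrm (u n - l).
  set v := n.+1%:R^-1; move: (inf D) => d a1 a3 a4 a5 a6 p1 p2 p3.
  have : (a - c) ^+ 2 <= b ^+ 2 \/ a <= c.
    by case: (lerP a c) => ?; [right | left; nra].
  case=> ?; nra.
exists l => // w Ww.
have Re0 v : cs_set W v -> complex.Re (ip v (x - l)) = 0.
  move=> Wv; apply: (quadratic_bound (sqr_ge0 (nrm v))) => t.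
  have := le_trans lmin (dD _ (cs_add Wl (cs_scale t%:C%C Wv))).
  rewrite opprD addrA (nrm_sqrB (x - l)) nrmZ ipZr Re_ip_sym exprMn.
  rewrite real_normK ?num_real //.
  have -> : complex.Re (t%:C%C * ip (x - l) v) = t * complex.Re (ip (x - l) v).
    by case: (ip _ _) => a b; simpc.
  rewrite (Re_ip_sym v); lra.
(* The imaginary part is the real part for [i w], which is again in [W]. *)
by rewrite ipE !Re0 //; exact: cs_scale.
Qed.

(** The default value 0 in the definition of [proj] is ruled out by the projection theorem. *)
Lemma proj_ortho x w : cs_set W w -> ip w (x - val (proj W x)) = 0.
Proof.
move=> Ww; rewrite /Defs.proj; case: xgetP => [p _ hp|].
  exact: hp (Sub w (mem_set Ww)).
have [p Wp hp] := projection_theorem x.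
by move=> /(_ (Sub p (mem_set Wp)))[] v; apply: hp; exact: set_mem (valP v).
Qed.

Lemma projW x : cs_set W (val (proj W x)).
Proof. exact: set_mem (valP (proj W x)). Qed.

Lemma proj_unique x p : cs_set W p -> (forall w, cs_set W w -> ip w (x - p) = 0) ->
  val (proj W x) = p.
Proof.
move=> Wp hp; apply/eqP; rewrite -subr_eq0; apply/eqP/nrm_sqr_eq0.
have Wd : cs_set W (val (proj W x) - p).
  by rewrite addrC -scaleN1r; apply: cs_lin => //; exact: projW.
apply: (@complexI R); rewrite -ipxx.
have -> : val (proj W x) - p = (x - p) - (x - val (proj W x)).
  by rewrite opprB [RHS]addrC addrA subrK.
rewrite [LHS]ipBr -[X in ip X _ - ip X _](_ : val (proj W x) - p = _).
  by rewrite hp // proj_ortho // subrr.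
by rewrite opprB [RHS]addrC addrA subrK.
Qed.

Lemma proj_lin : linear (proj W).
Proof.
move=> c x y; apply: val_inj.
have -> : val (c *: proj W x + proj W y) =
  c *: val (proj W x) + val (proj W y) by [].
apply: proj_unique => [|w Ww]; first by apply: cs_lin; exact: projW.
by rewrite opprD addrACA -scalerBr ipDr ipZr !proj_ortho // mulr0 addr0.
Qed.

Lemma nrm_val (w : cs_type W) : nrm (val w) = nrm w.
Proof. by []. Qed.

Lemma proj_pyth x :
  nrm x ^+ 2 = nrm (val (proj W x)) ^+ 2 + nrm (x - val (proj W x)) ^+ 2.
Proof.
rewrite -pythagoras; last exact/proj_ortho/projW.
by rewrite addrC subrK.
Qed.

Lemma nrm_proj x : nrm (proj W x) <= nrm x.
Proof.
rewrite -(@ler_pXn2r _ 2) ?nnegrE ?nrm_ge0 // (proj_pyth x) nrm_val.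
by rewrite lerDl sqr_ge0.
Qed.

Lemma ip_proj x (w : cs_type W) : ip w (proj W x) = ip (val w) x.
Proof.
have := proj_ortho x (set_mem (valP w)); rewrite ipBr => /eqP.
by rewrite subr_eq0 => /eqP ->.
Qed.

Lemma proj_id (w : cs_type W) : proj W (val w) = w.
Proof.
apply/val_inj/proj_unique; first exact: set_mem (valP w).
by move=> v _; rewrite subrr ip0r.
Qed.

End Projection.

(** * Adjoints and isometries *)

Section Adjoint.
Variables (R : realType).

Definition ker_subspace (H : hilbertType R) (W : normedModType R[i]) (T : H -> W)
    (bT : bounded_op T) : closed_subspace H :=
  ClosedSubspace (lin0 bT.1) (fun c x y => @op_ker_lin R H W T c x y bT.1)
    (closed_ker bT).

(** If [f] is not zero, take a vector where it does not vanish and let [u] be its component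
    orthogonal to the kernel. Since [x - (f x / f u) *: u] is in the kernel, a multiple of [u]
    represents [f]. *)
Lemma riesz (H : hilbertType R) (f : H -> R[i]^o) : bounded_op f ->
  exists y, forall x, f x = ip y x.
Proof.
move=> bf; have lf := bf.1.
pose N := ker_subspace bf.
have [f0|/existsNP[x0 /eqP fx0]] := pselect (forall x, f x = 0).
  by exists 0 => x; rewrite f0 ip0l.
pose u := x0 - val (proj N x0).
have fu : f u = f x0 by rewrite (linB lf) (projW N x0 : f _ = 0) subr0.
have fu0 : f u != 0 by rewrite fu.
have uu0 : ip u u != 0.
  apply: contraNneq fu0; rewrite ipxx => -[/nrm_sqr_eq0 ->].
  by rewrite (lin0 lf).
exists ((f u / ip u u)^* *: u) => x; rewrite ipZl conjCK.
have Nk : cs_set N (x - (f x / f u) *: u).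
  by rewrite /= /op_ker /= (linB lf) (linZ lf) /GRing.scale /= divfK // subrr.
have : ip u (x - (f x / f u) *: u) = 0 by exact: (ipC0 (proj_ortho x0 Nk)).
rewrite ipBr ipZr => /eqP; rewrite subr_eq0 => /eqP ->.
by field; rewrite fu0 uu0.
Qed.

Variables (H K : hilbertType R).

Lemma adjP (T : H -> K) : bounded_op T ->
  forall x y, ip (T x) y = ip x (adj T y).
Proof.
move=> bT; rewrite /adj; case: xgetP => [S _ //|].
have /choice[S hS] (y : K) : exists z, forall x, ip (T x) y = ip x z.
  (* The inner product is linear in its second slot, so Riesz is applied to [ip y (T x)] and the
     result conjugated; [nrm y + 1] keeps the bound positive when [y = 0]. *)
  have [|z hz] := @riesz H (fun x => ip y (T x)).
    have [lT [M M0 hM]] := (bounded_opP _).1 bT.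
    apply/bounded_opP; split=> [c x x'|]; first by rewrite lT ipDr ipZr.
    exists (M * (nrm y + 1)) => [|x].
      by rewrite mulr_gt0 // ltr_wpDl ?nrm_ge0.
    rewrite -lecR -nrmE (le_trans (ip_cauchy_schwarz _ _)) // !nrmE.
    rewrite -rmorphM /= lecR.
    have := hM x; have := nrm_ge0 y; have := nrm_ge0 (T x); nra.
  by exists z => x; rewrite ip_conj hz -ip_conj.
by move=> /(_ S)[] x y; exact: hS.
Qed.

Lemma adj_lin (T : H -> K) : bounded_op T -> linear (adj T).
Proof.
by move=> bT c x y; apply: ip_inj => z; rewrite -adjP // !ipDr !ipZr -!adjP.
Qed.

Definition lin_isometry (T : H -> K) := linear T /\ forall x, nrm (T x) = nrm x.

Variable T : H -> K.

Hypothesis iT : lin_isometry T.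

Lemma isometry_bounded : bounded_op T.
Proof.
apply/bounded_opP; split; first exact: iT.1.
by exists 1 => // x; rewrite mul1r iT.2.
Qed.

Lemma isometry_ip x y : ip (T x) (T y) = ip x y.
Proof.
have hRe u v : complex.Re (ip (T u) (T v)) = complex.Re (ip u v).
  have := nrm_sqrD (T u) (T v); rewrite -(linD iT.1) !iT.2 nrm_sqrD.
  by move: (complex.Re _) (complex.Re _) => a b; lra.
by rewrite ipE -(linZ iT.1) !hRe -ipE.
Qed.

Lemma isometry_inj : injective T.
Proof.
move=> x y xy; apply/eqP; rewrite -subr_eq0; apply/eqP/nrm0_eq0.
by rewrite -iT.2 (linB iT.1) xy subrr nrm0.
Qed.

Lemma isometry_adjK x : adj T (T x) = x.
Proof.
by apply: ip_inj => z; rewrite -adjP ?isometry_ip //; exact: isometry_bounded.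
Qed.

Lemma isometry_closed_range : closed (range T).
Proof.
apply: (closed_image isometry_bounded closedT ltr01) => x y _ _.
by rewrite -(linB iT.1) iT.2 mul1r.
Qed.

(* T T^* is the orthogonal projection onto the range of T. *)
Lemma isometry_projE h y : range T y -> (forall z, ip (T z) (h - y) = 0) ->
  T (adj T h) = y.
Proof.
move=> [z0 _ <-] hy; congr T; apply: ip_inj => z.
have := hy z; rewrite ipBr isometry_ip => /eqP; rewrite subr_eq0 => /eqP <-.
by rewrite -adjP //; exact: isometry_bounded.
Qed.

Lemma isometry_proj_ortho z h : ip (T z) (h - T (adj T h)) = 0.
Proof.
by rewrite ipBr isometry_ip adjP ?subrr //; exact: isometry_bounded.
Qed.

Lemma isometry_pyth h :
  nrm h ^+ 2 = nrm (adj T h) ^+ 2 + nrm (h - T (adj T h)) ^+ 2.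
Proof.
have := isometry_proj_ortho (adj T h) h => /pythagoras.
by rewrite iT.2 addrC subrK.
Qed.

Lemma nrm_adj_isometry h : nrm (adj T h) <= nrm h.
Proof.
rewrite -(@ler_pXn2r _ 2) ?nnegrE ?nrm_ge0 // (isometry_pyth h).
by rewrite lerDl sqr_ge0.
Qed.

End Adjoint.

Section GramIsometry.
Variables (R : realType) (K1 K2 : hilbertType R) (I : Type).
Variables (e : I -> K1) (f : I -> K2).
Hypothesis gram : forall i j, ip (f i) (f j) = ip (e i) (e j).

(** A vector may be a combination of the [e i] in several ways, so the span of the graph replaces a
    map; equality of norms on it later gives single-valuedness. *)
Let Q : set (K1 * K2)%type := lspan (range (fun i => (e i, f i))).

Let Q_ip p q : Q p -> Q q -> ip p.2 q.2 = ip p.1 q.1.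
Proof.
have Q1 i r : Q r -> ip (f i) r.2 = ip (e i) r.1.
  apply: (lspan_sub (W := [set r | ip (f i) r.2 = ip (e i) r.1]%classic)) => /=.
  - by rewrite !ip0r.
  - by move=> c x y hx hy; rewrite !ipDr !ipZr hx hy.
  - by move=> _ [j _ <-] /=.
move=> Qp Qq; move: Qp.
apply: (lspan_sub (W := [set r | ip r.2 q.2 = ip r.1 q.1]%classic)) => /=.
- by rewrite !ip0l.
- by move=> c x y hx hy; rewrite !ipDl !ipZl hx hy.
- by move=> _ [j _ <-] /=; exact: Q1.
Qed.

Let Q_nrm p : Q p -> nrm p.2 = nrm p.1.
Proof.
move=> Qp; apply/eqP; rewrite -(@eqrXn2 _ 2) ?nrm_ge0 //.
by apply/eqP/(@complexI R); rewrite -!ipxx; exact: Q_ip.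
Qed.

(** The closure of [Q], which is the graph of the isometry being built. *)
Let rel x y := forall d, 0 < d ->
  exists p, [/\ Q p, nrm (x - p.1) < d & nrm (y - p.2) < d].

Let rel_nrm x y : rel x y -> nrm y = nrm x.
Proof.
move=> h; apply/eqP; rewrite -subr_eq0 -normr_eq0 eq_le normr_ge0 andbT.
apply/ler_addgt0Pl => d d0; rewrite addr0.
have [p [Qp xp yp]] := h _ (divr_gt0 d0 (ltr0Sn _ 1)).
have := Q_nrm Qp; have := nrmDB x p.1 0; have := nrmDB p.1 x 0.
have := nrmDB y p.2 0; have := nrmDB p.2 y 0; rewrite !subr0.
rewrite (nrmB p.1) (nrmB p.2) => *; rewrite ler_norml; apply/andP; split; lra.
Qed.

Let rel_lin c x y x' y' : rel x y -> rel x' y' -> rel (c *: x + x') (c *: y + y').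
Proof.
move=> h h' d d0; pose m := complex.Re `|c|.
have m0 : 0 <= m by rewrite -lecR /m RRe_real // normr_ge0.
have d2 : 0 < d / (m + 1) by rewrite divr_gt0 // ltr_wpDl.
have [p [Qp xp yp]] := h _ (divr_gt0 d2 (ltr0Sn _ 1)).
have [p' [Qp' xp' yp']] := h' _ (divr_gt0 d2 (ltr0Sn _ 1)).
have key (V : normedModType R[i]) (u u' v v' : V) :
    nrm (u - v) < d / (m + 1) / 2 -> nrm (u' - v') < d / (m + 1) / 2 ->
    nrm (c *: u + u' - (c *: v + v')) < d.
  move=> h1 h2; rewrite opprD addrACA -scalerBr.
  apply: (le_lt_trans (nrmD _ _)); rewrite nrmZC -/m.
  have -> : d = m * (d / (m + 1)) + d / (m + 1).
    by field; rewrite gt_eqF // ltr_wpDl.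
  have := nrm_ge0 (u - v); nra.
exists (c *: p + p'); split; [exact: lspan_lin | exact: key | exact: key].
Qed.

(** Equal Gram matrices make the linear extension norm-preserving, and completeness of [K2] extends
    it from the span. With elementary tensors as [e], it produces the operators on tensor
    products. *)
Theorem gram_isometry : total_set (range e) ->
  exists2 S : K1 -> K2, lin_isometry S & forall i, S (e i) = f i.
Proof.
move=> /total_setP te.
have Q1 s : lspan (range e) s -> exists t, Q (s, t).
  apply: (lspan_sub (W := [set s | exists t, Q (s, t)]%classic)) => /=.
  - by exists 0; exact: lspan0.
  - move=> c x y [t Qt] [t' Qt']; exists (c *: t + t').
    exact: (@lspan_lin _ _ _ c (x, t) (y, t') Qt Qt').
  - by move=> _ [i _ <-]; exists (f i); apply: sub_lspan; exists i.
have /choice[S hS] x : exists y, rel x y.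
  have /choice[u hu] (n : nat) : exists p, Q p /\ nrm (x - p.1) < n.+1%:R^-1.
    have n0 : 0 < n.+1%:R^-1 :> R by rewrite invr_gt0.
    by have [s /Q1[t Qt] xs] := te x _ n0; exists (s, t).
  have [l hl] : exists l, forall d, 0 < d -> exists N, forall n, (N <= n)%N ->
      nrm ((u n).2 - l) < d.
    apply: nrm_cauchy_cvg => d d0.
    have [N hN] := invS_small (divr_gt0 d0 (ltr0Sn _ 1)).
    exists N => m n /hN hm /hN hn.
    (* Differences stay in [Q], whose coordinates have equal norms: the second coordinates are
       Cauchy because the first ones converge. *)
    have Qd : Q (u m - u n).
      rewrite addrC -scaleN1r.
      by apply: lspan_lin; [exact: (hu n).1 | exact: (hu m).1].
    rewrite (Q_nrm Qd : nrm ((u m).2 - (u n).2) = nrm ((u m).1 - (u n).1)).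
    apply: (le_lt_trans (nrmDB _ x _)); rewrite [d]splitr [nrm (_ - x)]nrmB.
    by apply: ltrD; [exact: lt_trans (hu m).2 hm | exact: lt_trans (hu n).2 hn].
  exists l => d d0; have [N1 h1] := hl _ d0; have [N2 h2] := invS_small d0.
  exists (u (maxn N1 N2)); split; first exact: (hu _).1.
    by apply: (lt_trans (hu _).2); apply: h2; exact: leq_maxr.
  by rewrite nrmB h1 // leq_maxl.
have rel_fun x y y' : rel x y -> rel x y' -> y = y'.
  move=> h h'; apply/eqP; rewrite -subr_eq0 addrC -scaleN1r; apply/eqP/nrm0_eq0.
  by rewrite (rel_nrm (rel_lin (-1) h' h)) scaleN1r addNr nrm0.
exists S => [|i]; first split.
- by move=> c x y; apply: (rel_fun _ _ _ (hS _)); exact: rel_lin.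
- by move=> x; exact/rel_nrm/hS.
apply: (rel_fun _ _ _ (hS _)) => d d0; exists (e i, f i).
by rewrite !subrr !nrm0; split=> //; apply: sub_lspan; exists i.
Qed.

End GramIsometry.

(** * Compact operators and finite dimension *)

Section Compact.
Variables (R : realType) (V W : normedModType R[i]) (C : V -> W).
Hypothesis cC : compact_op C.

(** Stands in for a convergent subsequence: the cluster point is approached at arbitrarily late
    indices, so another sequence tending to 0 can be made small at the same index. *)
Lemma compact_op_cluster (u : nat -> V) : (forall n, nrm (u n) <= 1) ->
  exists y, forall e, 0 < e -> forall N, exists2 n, (N <= n)%N &
    nrm (C (u n) - y) < e.
Proof.
move=> hu; move: cC; rewrite /compact_op precompactE => cB.
have FF : ProperFilter ((C \o u) @ \oo)%classic by exact: fmap_proper_filter.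
have [|y [_ cy]] := cB _ FF.
  exists 0%N => // n _ /=; apply: subset_closure; exists (u n) => //=.
  by rewrite nrmE lecR.
exists y => e e0 N.
have e0' : 0 < e%:C%C :> R[i] by rewrite ltcR.
have [|_ [[n Nn <-]]] := cy ((C \o u) @` [set n | (N <= n)%N])%classic _ _
  (nbhsx_ballx y _ e0').
  by exists N => // n /= Nn; exists n.
by rewrite -ball_normE /= nrmE ltcR nrmB => yn; exists n.
Qed.

Lemma compact_op_totally_bounded e : 0 < e -> exists s : seq W,
  forall x, nrm x <= 1 -> exists2 y, y \in s & nrm (C x - y) < e.
Proof.
move=> e0; move: cC; rewrite /compact_op precompactE compact_cover => cB.
have e0' : 0 < e%:C%C :> R[i] by rewrite ltcR.
have [| |D _ hD] := cB W setT (fun y => ball y e%:C%C).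
- by move=> y _; exact: ball_open.
- by move=> y _; exists y => //; exact: ballxx.
exists (finmap.enum_fset D) => x x1.
have [|y /= yD] := hD (C x).
  by apply: subset_closure; exists x => //=; rewrite nrmE lecR.
by rewrite -ball_normE /= nrmE ltcR nrmB; exists y.
Qed.

End Compact.

Section FiniteDim.
Variables (R : realType).

Section Transport.
Variables (V W : lmodType R[i]) (f : V -> W).
Hypotheses (lf : linear f) (inj_f : injective f).

Lemma lspan_image (X : set V) : lspan (f @` X)%classic = (f @` lspan X)%classic.
Proof.
apply/seteqP; split.
  apply: lspan_sub.
  - by exists 0; [exact: lspan0 | exact: lin0].
  - move=> c _ _ [x Xx <-] [y Xy <-]; exists (c *: x + y); first exact: lspan_lin.
    exact: lf.
  - by move=> _ [x Xx <-]; exists x => //; exact: sub_lspan.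
move=> _ [x Xx <-].
apply: (lspan_sub (W := [set x | lspan (f @` X) (f x)]%classic)) Xx => /=.
- by rewrite (lin0 lf); exact: lspan0.
- by move=> c u v hu hv; rewrite lf; exact: lspan_lin.
- by move=> u Xu; apply: sub_lspan; exists u.
Qed.

Lemma is_basis_image (S : set V) n :
  (exists b : 'I_n -> W, is_basis (f @` S)%classic b) <->
  (exists b : 'I_n -> V, is_basis S b).
Proof.
split=> [[b [bf bS]]|[b [bf ->]]]; last first.
  exists (f \o b); split=> [c|]; last by rewrite -lspan_image image_comp.
  under eq_bigr do rewrite /= -(linZ lf).
  by rewrite -(lin_sum lf) -(lin0 lf) => /inj_f; exact: bf.
have /choice[a ha] k : exists x, S x /\ f x = b k.
  have : lspan (range b) (b k) by apply: sub_lspan; exists k.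
  by rewrite -bS => -[x Sx fx]; exists x.
have ba : b = f \o a by apply/funext => k; rewrite /= (ha k).2.
exists a; split=> [c c0|].
  apply: bf; rewrite -[RHS](lin0 lf) -c0 (lin_sum lf).
  by apply: eq_bigr => k _; rewrite (linZ lf) ba.
have fS : (f @` S = f @` lspan (range a))%classic.
  by rewrite bS ba -lspan_image image_comp.
by apply/seteqP; split=> x Sx;
  [have : (f @` lspan (range a))%classic (f x) by rewrite -fS; exists x
  |have : (f @` S)%classic (f x) by rewrite fS; exists x] => -[y ? /inj_f <-].
Qed.

Lemma finite_dim_image (S : set V) : finite_dim (f @` S)%classic <-> finite_dim S.
Proof. by split=> -[n hn]; exists n; apply/is_basis_image. Qed.

(** [dimension] is a choice from the set of sizes of bases, and this set is the same for [S] and its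
    image; in infinite dimension both values are the default 0. *)
Lemma dimension_image (S : set V) : dimension (f @` S)%classic = dimension S.
Proof.
rewrite /dimension; congr xget; apply/funext => n; apply/propext.
exact: is_basis_image.
Qed.

End Transport.

Section Orthonormal.
Variables (H : hilbertType R) (S : set H).
Hypotheses (S0 : S 0) (Sl : forall c x y, S x -> S y -> S (c *: x + y)).

Definition orthonormal n (b : 'I_n -> H) :=
  forall i j, ip (b i) (b j) = (i == j)%:R.

Lemma orthonormal_ip n (b : 'I_n -> H) c k : orthonormal b ->
  ip (b k) (\sum_(i < n) c i *: b i) = c k.
Proof.
move=> ob; rewrite ip_sumr (bigD1 k) //= big1 => [|i ik].
  by rewrite ipZr ob eqxx mulr1 addr0.
by rewrite ipZr ob eq_sym (negbTE ik) mulr0.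
Qed.

(** Gram-Schmidt: an orthonormal family that does not span [S] misses some [x], and the normalized
    residual [x - c x] is appended at the last index. *)
Lemma finite_dim_or_orthonormal n : finite_dim S \/
  exists2 b : 'I_n -> H, orthonormal b & forall k, S (b k).
Proof.
elim: n => [|n [|[b ob Sb]]]; first by right; exists (fun=> 0) => -[].
  by left.
pose c x := \sum_(k < n) ip (b k) x *: b k.
have Sc a : S (\sum_(k < n) a k *: b k).
  elim/big_ind: _ => // [x y Sx Sy|i _]; first by rewrite -[x]scale1r; exact: Sl.
  by rewrite -[_ *: _]addr0; apply: Sl; [exact: Sb|exact: S0].
have [Sspan|] := pselect (forall x, S x -> x = c x).
  left; exists n, b; split=> [a a0 k|].
    by rewrite -(orthonormal_ip a k ob) a0 ip0r.
  apply/seteqP; split=> [x /Sspan ->|].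
    by exists n, (fun k => ip (b k) x), b; split=> // k; exists k.
  by apply: lspan_sub => // _ [k _ <-].
move=> /existsNP[x /not_implyP[Sx xc]]; right.
pose r := x - c x.
have Sr : S r by rewrite /r addrC -scaleN1r; apply: Sl; [exact: Sc|].
have br k : ip (b k) r = 0 by rewrite ipBr orthonormal_ip // subrr.
have r0 : nrm r != 0.
  by apply: contra_notN xc => /eqP/nrm0_eq0/eqP; rewrite subr_eq0 => /eqP.
pose v := ((nrm r)^-1)%:C%C *: r.
have bv k : ip (b k) v = 0 by rewrite ipZr br mulr0.
have vv : ip v v = 1.
  rewrite ipxx nrmZ ger0_norm ?invr_ge0 ?nrm_ge0 // mulVf //.
  by rewrite expr1n.
exists (fun k => if unlift ord_max k is Some j then b j else v) => [i j|k].
  case: (unliftP ord_max i) => [i' ->|->]; case: (unliftP ord_max j) => [j' ->|->].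
  - by rewrite ob (inj_eq lift_inj).
  - by rewrite bv eq_sym (negbTE (neq_lift _ _)).
  - by rewrite (ipC0 (bv _)) (negbTE (neq_lift _ _)).
  - by rewrite vv eqxx.
case: (unliftP ord_max k) => [j _|_]; first exact: Sb.
by rewrite /v -[_ *: _]addr0; exact: Sl.
Qed.

(* An orthonormal family of S has points at mutual distance sqrt 2, and so do
   their images under C; hence a 1/2-net of the image of the unit ball bounds
   the cardinality of the family. *)
Lemma compact_isometric_finite_dim (C : H -> H) : compact_op C ->
  (forall x y, S x -> S y -> nrm (C x - C y) = nrm (x - y)) -> finite_dim S.
Proof.
move=> cC hC.
have h0 : 0 < 2^-1 :> R by rewrite invr_gt0.
have [s hs] := compact_op_totally_bounded cC h0.
have [//|[b ob Sb]] := finite_dim_or_orthonormal (size s).+1.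
have nb k : nrm (b k) ^+ 2 = 1.
  by apply: (@complexI R); rewrite -ipxx ob eqxx rmorph1.
have /choice[y hy] k : exists y, y \in s /\ nrm (C (b k) - y) < 2^-1.
  have [|y ys yk] := hs (b k); last by exists y.
  by rewrite -(@ler_pXn2r _ 2) ?nnegrE ?nrm_ge0 // nb expr1n.
have ys k : (index (y k) s < size s)%N by rewrite index_mem (hy k).1.
pose g k : 'I_(size s) := Ordinal (ys k).
have [|] := pselect (injective g).
  by move=> /leq_card; rewrite !card_ord ltnn.
move=> /existsNP[i /existsNP[j /not_implyP[gij ij]]]; exfalso.
have yij : y i = y j.
  have /= iij := congr1 val gij.
  by rewrite -(nth_index 0 (hy i).1) -(nth_index 0 (hy j).1) iij.
have := nrmDB (C (b i)) (y i) (C (b j)); rewrite hC // {2}yij (nrmB (y j)).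
have := (hy i).2; have := (hy j).2; have := nrm_sqrB (b i) (b j).
rewrite !nb ob; have /negbTE -> : i != j by exact/eqP.
rewrite /= mulr0 subr0; have := nrm_ge0 (b i - b j); nra.
Qed.

End Orthonormal.
End FiniteDim.

(** * Compact differences of projections *)

Section DifferenceOfProjections.
Variables (R : realType) (H K : hilbertType R) (W : closed_subspace H).
Variables (J : K -> H) (C : H -> H).
Hypothesis iJ : lin_isometry J.
Hypothesis CE : forall h, C h = val (proj W h) - J (adj J h).

Let G z : cs_type W := proj W (J z).

Let bJ : bounded_op J := isometry_bounded iJ.

Lemma proj_isometry_lin : linear G.
Proof. by move=> c x y; rewrite /G iJ.1 proj_lin. Qed.

Lemma nrm_proj_isometry z : nrm (G z) <= nrm z.
Proof. by rewrite (le_trans (nrm_proj W _)) // iJ.2. Qed.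

Lemma proj_isometry_bounded : bounded_op G.
Proof.
apply/bounded_opP; split; first exact: proj_isometry_lin.
by exists 1 => // z; rewrite mul1r nrm_proj_isometry.
Qed.

(** The adjoint of the projection onto [W] is the inclusion of [W]. *)
Lemma adj_proj_isometry w : adj G w = adj J (val w).
Proof.
apply: ip_inj => z; rewrite -adjP; last exact: proj_isometry_bounded.
by rewrite -adjP // ip_conj ip_proj -ip_conj.
Qed.

(** Both squares lie between 0 and [nrm h ^+ 2]. Hence the eigenvalue 1 forces [adj J h = 0] and [h]
    in [W], while -1 forces [proj W h = 0] and [h] in the range of [J]. *)
Lemma Re_ip_defect h :
  complex.Re (ip h (C h)) = nrm (proj W h) ^+ 2 - nrm (adj J h) ^+ 2.
Proof.
rewrite CE ipBr raddfB /=.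
have -> : ip h (val (proj W h)) = ip (proj W h) (proj W h).
  by rewrite ip_conj -ip_proj -ip_conj.
have -> : ip h (J (adj J h)) = ip (adj J h) (adj J h).
  by rewrite ip_conj adjP // -ip_conj.
by rewrite !ipxx.
Qed.
Lemma eigenspace1E :
  op_eigenspace C 1 = (val @` op_ker (adj G))%classic.
Proof.
apply/seteqP; split=> [h|_ [w w0 <-]]; rewrite /op_eigenspace /op_ker /=.
  rewrite scale1r => /eqP; rewrite subr_eq0 => /eqP Ch.
  have := Re_ip_defect h; rewrite Ch ipxx /= => hh.
  have J0 : adj J h = 0.
    apply: nrm_sqr_eq0; have := proj_pyth W h; have := sqr_ge0 (nrm (adj J h)).
    have := sqr_ge0 (nrm (h - val (proj W h))); rewrite nrm_val; lra.
  have Wh : val (proj W h) = h by rewrite -[RHS]Ch CE J0 (lin0 iJ.1) subr0.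
  by exists (proj W h) => //; rewrite /op_ker /= adj_proj_isometry Wh.
move: w0; rewrite /op_ker /= adj_proj_isometry => w0.
by rewrite CE w0 (lin0 iJ.1) subr0 proj_id scale1r subrr.
Qed.

Lemma eigenspaceN1E : op_eigenspace C (-1) = (J @` op_ker G)%classic.
Proof.
apply/seteqP; split=> [h|_ [z z0 <-]]; rewrite /op_eigenspace /op_ker /=.
  rewrite scaleN1r opprK => /eqP; rewrite addr_eq0 => /eqP Ch.
  have := Re_ip_defect h; rewrite Ch ipNr ipxx /= => hh.
  have W0 : proj W h = 0.
    apply: nrm_sqr_eq0; have := isometry_pyth iJ h; have := sqr_ge0 (nrm (proj W h)).
    have := sqr_ge0 (nrm (h - J (adj J h))); lra.
  have Jh : J (adj J h) = h.
    by apply: oppr_inj; rewrite -Ch CE W0 sub0r.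
  by exists (adj J h) => //; rewrite /op_ker /= /G Jh.
rewrite CE isometry_adjK // -[proj W (J z)]/(G z) z0.
by rewrite sub0r scaleN1r opprK addNr.
Qed.

Hypothesis cC : compact_op C.

(** [J] carries this kernel onto the eigenspace where [C] is -1, so [C] is both compact and
    isometric there. *)
Lemma ker_proj_isometry_finite_dim : finite_dim (op_ker G).
Proof.
apply/(finite_dim_image iJ.1 (isometry_inj iJ)).
apply: (compact_isometric_finite_dim _ _ cC).
- by exists 0; rewrite /op_ker /= ?(lin0 iJ.1) ?(lin0 proj_isometry_lin).
- move=> c _ _ [x x0 <-] [y y0 <-]; exists (c *: x + y); last by rewrite iJ.1.
  exact: op_ker_lin proj_isometry_lin x0 y0.
- rewrite -eigenspaceN1E => x y; rewrite /op_eigenspace /op_ker /=.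
  rewrite !scaleN1r !opprK => /eqP + /eqP.
  by rewrite !addr_eq0 => /eqP -> /eqP ->; rewrite -opprD nrmN.
Qed.

Lemma ker_adj_proj_isometry_finite_dim : finite_dim (op_ker (adj G)).
Proof.
have lv : linear (val : cs_type W -> H) by [].
apply/(finite_dim_image lv val_inj).
have lA := adj_lin proj_isometry_bounded.
apply: (compact_isometric_finite_dim _ _ cC).
- by exists 0; rewrite /op_ker /= ?(lin0 lA).
- move=> c _ _ [x x0 <-] [y y0 <-]; exists (c *: x + y) => //.
  exact: op_ker_lin lA x0 y0.
- rewrite -eigenspace1E => x y; rewrite /op_eigenspace /op_ker /=.
  rewrite !scale1r => /eqP + /eqP.
  by rewrite !subr_eq0 => /eqP -> /eqP ->.
Qed.

Let N : closed_subspace K := ker_subspace proj_isometry_bounded.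

Let M := Defs.ortho (op_ker G).

(* On the range of J one has 1 + C = proj W, so that 1 + C is a compact
   perturbation of the identity there. *)
Lemma proj_isometryE z : C (J z) + J z = val (G z).
Proof. by rewrite CE isometry_adjK // subrK. Qed.

Lemma proj_isometry_bounded_below : exists2 d : R, 0 < d &
  forall z, cs_set M z -> d * nrm z <= nrm (G z).
Proof.
apply: contrapT => /forall2NP hM.
have /choice[u hu] (n : nat) : exists z,
    [/\ cs_set M z, nrm z = 1 & nrm (G z) < n.+1%:R^-1].
  have [|/existsNP[z /not_implyP[Mz /negP]]] := hM n.+1%:R^-1.
    by rewrite invr_gt0 ltr0Sn.
  rewrite -ltNge => zn.
  have z0 : nrm z != 0.
    by apply: contraTneq zn => z0; rewrite z0 mulr0 -leNgt nrm_ge0.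
  have zp : 0 < nrm z by rewrite lt_neqAle eq_sym z0 nrm_ge0.
  have zv : 0 < (nrm z)^-1 by rewrite invr_gt0.
  exists ((nrm z)^-1%:C%C *: z); split; first exact: cs_scale.
    by rewrite nrmZ gtr0_norm // mulVf.
  by rewrite (linZ proj_isometry_lin) nrmZ gtr0_norm // mulrC ltr_pdivrMr.
have [|y hy] := compact_op_cluster cC (u := J \o u).
  by move=> n; rewrite /= iJ.2; have [_ -> _] := hu n.
(* [C (J (u n))] clusters at [y] and [C (J (u n)) + J (u n)] tends to 0, so [J (u n)] clusters at
   [- y]; applying the contraction [adj J] shows that [u n] clusters at [z]. *)
pose z := adj J (- y).
have near_z e : 0 < e -> exists n, nrm (u n - z) < e /\ nrm (G (u n)) < e.
  move=> e0; have [k hk] := invS_small (divr_gt0 e0 (ltr0Sn _ 1)).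
  have [n kn yn] := hy _ (divr_gt0 e0 (ltr0Sn _ 1)) k.
  have [_ _ Gn] := hu n; have {}Gn := lt_trans Gn (hk n kn).
  exists n; split; last by have := nrm_ge0 (G (u n)); lra.
  have -> : u n - z = adj J (J (u n) + y).
    by rewrite (linD (adj_lin bJ)) isometry_adjK // /z (linN (adj_lin bJ)) opprK.
  apply: (le_lt_trans (nrm_adj_isometry iJ _)).
  have -> : J (u n) + y = val (G (u n)) - (C (J (u n)) - y).
    rewrite -proj_isometryE opprB [C _ + _]addrC -addrA.
    by rewrite [C _ + (y - _)]addrCA subrr addr0.
  apply: (le_lt_trans (nrmD _ _)); rewrite nrmN nrm_val [e]splitr.
  exact: ltrD.
have Mz : cs_set M z.
  apply: (proj1 (closedP _) (@cs_closed _ _ M)) => e /near_z[n [un _]].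
  by exists (u n); [have [] := hu n | rewrite nrmB].
have Gz : G z = 0.
  apply: nrm_eq0_lt => e e0.
  have [n [un Gn]] := near_z _ (divr_gt0 e0 (ltr0Sn _ 1)).
  have -> : G z = G (z - u n) + G (u n) by rewrite -(linD proj_isometry_lin) subrK.
  apply: (le_lt_trans (nrmD _ _)); rewrite [e]splitr; apply: ltrD => //.
  by rewrite (le_lt_trans (nrm_proj_isometry _)) // nrmB.
(* [z] lies in the kernel of [G] and in its orthogonal complement, whereas the unit vectors [u n]
   come within distance 1 of it. *)
have z0 : z = 0.
  by apply: nrm_sqr_eq0; apply: (@complexI R); rewrite -ipxx; exact: Mz.
have [n [un _]] := near_z 1 ltr01; have [_ un1 _] := hu n.
by move: un; rewrite z0 subr0 un1 ltxx.
Qed.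

Lemma proj_isometry_closed_range : closed (range G).
Proof.
have [d d0 hd] := proj_isometry_bounded_below.
(* Subtracting the projection onto the kernel leaves [G z] unchanged, so the lower bound on the
   complement governs the whole range. *)
have -> : range G = (G @` (M : set K))%classic.
  apply/seteqP; split=> _ [z _ <-]; last by exists z.
  exists (z - val (proj N z)); first by move=> k Gk; exact: proj_ortho.
  by rewrite (linB proj_isometry_lin) (projW N z : G _ = 0) subr0.
have d0' : 0 < d^-1 by rewrite invr_gt0.
apply: (closed_image proj_isometry_bounded (@cs_closed _ _ M) d0') => x y Mx My.
rewrite ler_pdivlMl // -(linB proj_isometry_lin); apply: hd.
by rewrite addrC -scaleN1r; exact: cs_lin.
Qed.

Theorem proj_isometry_fredholm : fredholm_op G.
Proof.
split; first exact: proj_isometry_closed_range.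
- exact: ker_proj_isometry_finite_dim.
- exact: ker_adj_proj_isometry_finite_dim.
Qed.

Theorem proj_isometry_index : op_index G =
  (dimension (op_eigenspace C (-1)))%:Z - (dimension (op_eigenspace C 1))%:Z.
Proof.
rewrite eigenspaceN1E eigenspace1E (dimension_image iJ.1 (isometry_inj iJ)).
by rewrite (@dimension_image _ _ _ (val : cs_type W -> H) _ val_inj).
Qed.

End DifferenceOfProjections.

(** * Representations of C*-algebras and correspondences *)

Section Cstar.
Variables (R : realType) (A : cstarType R).
Implicit Types a b c : A.

Lemma nrm_cmul a b : nrm (cmul a b) <= nrm a * nrm b.
Proof. by rewrite -lecR rmorphM /= -!nrmE cmul_norm. Qed.

Lemma nrm_cmul_star a : nrm (cmul (star a) a) = nrm a ^+ 2.
Proof. by apply: (@complexI R); rewrite rmorphXn /= -!nrmE star_norm. Qed.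

Lemma nrm_star a : nrm (star a) = nrm a.
Proof.
have le b : nrm b <= nrm (star b).
  have [->|b0] := eqVneq (nrm b) 0; first exact: nrm_ge0.
  have bp : 0 < nrm b by rewrite lt_neqAle eq_sym b0 nrm_ge0.
  by rewrite -(ler_pM2r bp) -expr2 -nrm_cmul_star nrm_cmul.
by apply/eqP; rewrite eq_le le -{2}[a]starK le.
Qed.

Lemma starD a b : star (a + b) = star a + star b.
Proof. by have := star_conjlinear 1 a b; rewrite rmorph1 !scale1r. Qed.

Lemma star0 : star 0 = 0 :> A.
Proof. by have := starD 0 0; rewrite addr0 -[LHS]addr0 => /addrI. Qed.

Lemma starZ (t : R) a : star (t%:C%C *: a) = t%:C%C *: star a.
Proof.
have := star_conjlinear t%:C%C a 0; rewrite star0 !addr0 => ->.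
by congr (_ *: _); rewrite /Num.conj /=; simpc.
Qed.

Let half (c : A) : A := (2^-1 : R)%:C%C *: c.

Let nrm_half c : nrm (half c) = nrm c / 2.
Proof. by rewrite nrmZ ger0_norm ?invr_ge0 // mulrC. Qed.

(* c solves c + c - c^2 = b, which is (1 - c)^2 = 1 - b in the unitization; it
   is obtained as the fixed point of the contraction c |-> (b + c^2) / 2. *)
Lemma selfadjoint_sqrt b : star b = b -> nrm b < 1 ->
  exists2 c, star c = c & c + c - cmul c c = b.
Proof.
move=> bs b1; have b0 := nrm_ge0 b.
pose f c := half (b + cmul c c).
pose u n := iter n f 0.
(* With [nrm b = 2 * r - 1] and [r < 1], the ball of radius [r] is stable under [f], and [f] is
   [r]-Lipschitz on it. *)
pose r := (1 + nrm b) / 2.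
have r0 : 0 <= r by rewrite /r; lra.
have r1 : r < 1 by rewrite /r; lra.
have ur n : nrm (u n) <= r.
  elim: n => [|n IH]; first by rewrite nrm0.
  rewrite nrm_half ler_pdivrMr //; apply: (le_trans (nrmD _ _)).
  have := nrm_cmul (u n) (u n); have := nrm_ge0 (u n).
  have : nrm b = 2 * r - 1 by rewrite /r; lra.
  nra.
have fB c d : nrm c <= r -> nrm d <= r -> nrm (f c - f d) <= r * nrm (c - d).
  move=> cr dr.
  (* Factorization of a difference of squares without commutativity. *)
  have -> : f c - f d = half (cmul c (c - d) + cmul (c - d) d).
    rewrite /f /half -scalerBr (linB (cmul_bilinear.1 c)).
    rewrite (linB (cmul_bilinear.2 d)); congr (_ *: _).
    by rewrite opprD addrACA subrr add0r addrA subrK.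
  rewrite nrm_half ler_pdivrMr //; apply: (le_trans (nrmD _ _)).
  have := nrm_cmul c (c - d); have := nrm_cmul (c - d) d.
  have := nrm_ge0 (c - d); have := nrm_ge0 c; have := nrm_ge0 d; nra.
have uS n : nrm (u n.+1 - u n) <= r ^+ n.
  elim: n => [|n IH].
    rewrite /u /= subr0 /f nrm_half (lin0 (cmul_bilinear.1 0)) addr0; lra.
  by rewrite exprS; apply: (le_trans (fB _ _ (ur n.+1) (ur n))); exact: ler_wpM2l.
have uD k n : nrm (u (n + k)%N - u n) <= r ^+ n / (1 - r).
  suff: nrm (u (n + k)%N - u n) <= r ^+ n * (1 - r ^+ k) / (1 - r).
    move=> /le_trans; apply; rewrite ler_pM2r ?invr_gt0 ?subr_gt0 //.
    by rewrite ler_piMr ?exprn_ge0 // gerBl exprn_ge0.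
  elim: k => [|k IH]; first by rewrite addn0 subrr nrm0 expr0 subrr mulr0 mul0r.
  rewrite addnS; apply: (le_trans (nrmDB _ (u (n + k)%N) _)).
  apply: (le_trans (lerD (uS _) IH)); rewrite exprD exprS.
  have r1' : 1 - r != 0 by rewrite subr_eq0 gt_eqF.
  by rewrite le_eqVlt; apply/orP; left; apply/eqP; field.
have rsmall e : 0 < e -> exists N, forall n, (N <= n)%N -> r ^+ n < e.
  move=> e0; have : `|r| < 1 by rewrite ger0_norm.
  move=> /cvg_expr/cvgrPdist_lt/(_ _ e0)[N _ hN].
  by exists N => n /hN; rewrite /= sub0r normrN ger0_norm // exprn_ge0.
have [c hc] : exists c, forall e, 0 < e -> exists N, forall n, (N <= n)%N ->
    nrm (u n - c) < e.
  apply: nrm_cauchy_cvg => e e0.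
  have e1 : 0 < e * (1 - r) by rewrite mulr_gt0 // subr_gt0.
  have [N hN] := rsmall _ e1; exists N => m n Nm Nn.
  wlog mn : m n Nm Nn / (m <= n)%N.
    by case: (leqP m n) => [|/ltnW] h H; [apply: H | rewrite nrmB; apply: H].
  rewrite nrmB -(subnKC mn) (le_lt_trans (uD _ _)) //.
  by rewrite ltr_pdivrMr ?subr_gt0 // hN.
have us n : star (u n) = u n.
  by elim: n => [|n IH]; rewrite ?star0 // /u /= /f starZ starD starM bs -/(u n) IH.
have cs : star c = c.
  apply/eqP; rewrite -subr_eq0; apply/eqP/nrm_eq0_lt => e e0.
  have [N hN] := hc _ (divr_gt0 e0 (ltr0Sn _ 1)).
  apply: (le_lt_trans (nrmDB _ (u N) _)); rewrite [e]splitr.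
  apply: ltrD; last exact: hN.
  have -> : star c - u N = star (c - u N).
    by rewrite starD -{1}us -[in RHS]scaleN1r -(rmorphN1 (real_complex R)) starZ
      rmorphN1 scaleN1r us.
  by rewrite nrm_star nrmB hN.
have cr : nrm c <= r.
  apply/ler_addgt0Pr => e /hc[N /(_ N (leqnn _))].
  have := ur N; have := nrmDB c (u N) 0; rewrite !subr0 (nrmB c); lra.
have fc : f c = c.
  apply/eqP; rewrite -subr_eq0; apply/eqP/nrm_eq0_lt => e e0.
  have [N hN] := hc _ (divr_gt0 e0 (ltr0Sn _ 1)).
  apply: (le_lt_trans (nrmDB _ (u N.+1) _)); rewrite [e]splitr.
  apply: ltrD; last by apply: hN.
  apply: (le_lt_trans (fB _ _ cr (ur N))); rewrite nrmB.
  have := hN _ (leqnn N); have := nrm_ge0 (u N - c); nra.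
exists c => //; apply/eqP; rewrite subr_eq; apply/eqP.
rewrite -{1 2}fc /f /half -scalerDl -rmorphD /=.
have -> : 2^-1 + 2^-1 = 1 :> R by field.
by rewrite rmorph1 scale1r.
Qed.

End Cstar.

Section Contractive.
Variables (R : realType) (A : cstarType R) (H : hilbertType R).
Variables (sigma : A -> H -> H).
Hypothesis rs : representation sigma.

(** Writing [b = c + c - cmul c c], the difference of the two sides is
    [nrm (h - sigma c h) ^+ 2]. *)
Lemma rep_selfadjoint_le b h : star b = b -> nrm b < 1 ->
  complex.Re (ip h (sigma b h)) <= nrm h ^+ 2.
Proof.
move=> bs /(selfadjoint_sqrt bs)[c cs <-].
rewrite (linB (rep_linear rs h)) (linD (rep_linear rs h)) (rep_mul rs).
rewrite ipBr ipDr.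
have -> : ip h (sigma c (sigma c h)) = ip (sigma c h) (sigma c h).
  by rewrite (rep_star rs) cs.
rewrite raddfB raddfD /= ipxx /=.
have := nrm_sqrB h (sigma c h); have := sqr_ge0 (nrm (h - sigma c h)); lra.
Qed.

Theorem rep_contractive a h : nrm (sigma a h) <= nrm a * nrm h.
Proof.
have a0 := nrm_ge0 a; have h0 := nrm_ge0 h.
(* Taking [t] strictly above [nrm a] makes the norm of [t ^- 2] times [cmul (star a) a] less than 1;
   then [t] decreases to [nrm a]. *)
have key t : nrm a < t -> nrm (sigma a h) <= t * nrm h.
  move=> at_; have t0 : 0 < t by lra.
  pose b := (t ^- 2)%:C%C *: cmul (star a) a.
  have bs : star b = b by rewrite starZ starM starK.
  have b1 : nrm b < 1.
    rewrite nrmZ nrm_cmul_star gtr0_norm ?invr_gt0 ?exprn_gt0 //.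
    rewrite mulrC ltr_pdivrMr ?exprn_gt0 // mul1r.
    by rewrite ltr_pXn2r // ?nnegrE // ltW.
  have := rep_selfadjoint_le h bs b1.
  rewrite (linZ (rep_linear rs h)) (rep_mul rs) ipZr.
  rewrite -(rep_star rs) ipxx -rmorphM /=.
  rewrite ler_pdivrMl ?exprn_gt0 // -exprMn ler_pXn2r ?nnegrE ?nrm_ge0 //.
  by rewrite mulr_ge0 // ltW.
apply/ler_addgt0Pr => e e0.
have h1 : 0 < nrm h + 1 by lra.
have d0 : 0 < e / (nrm h + 1) by rewrite divr_gt0.
have /key/le_trans -> // : nrm a < nrm a + e / (nrm h + 1) by lra.
rewrite mulrDl lerD2l mulrAC ler_pdivrMr //; nra.
Qed.

End Contractive.

Section HilbertModules.
Variables (R : realType) (A : cstarType R).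

Lemma nrm_rip (F : hilbertModType A) (x : F) : nrm (rip x x : A) = nrm x ^+ 2.
Proof. by apply: (@complexI R); rewrite rmorphXn /= -!nrmE -rip_norm. Qed.

Lemma rip_inj (F : hilbertModType A) (x y : F) :
  (forall z, rip z x = rip z y :> A) -> x = y.
Proof.
move=> h; apply/eqP; rewrite -subr_eq0; apply/eqP/nrm0_eq0/eqP.
rewrite -sqrf_eq0 -nrm_rip (linB (rip_linear (x - y))) h subrr.
by rewrite nrm0.
Qed.

Variable F : corrType A.

Lemma rip_lact b (x y : F) : rip x (lact b y) = rip (lact (star b) x) y :> A.
Proof. by rewrite lact_adj starK. Qed.

(** Adjointable maps are automatically right module maps, as pairing with an arbitrary [z] shows. *)
Lemma ract_lact b (x : F) a : ract (lact b x) a = lact b (ract x a).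
Proof. by apply: rip_inj => z; rewrite rip_lact !rip_ract rip_lact. Qed.

Variables (H : hilbertType R) (sigma : A -> H -> H) (T : htensor F sigma).

Lemma nrm_ht : representation sigma ->
  forall x h, nrm (ht T x h) <= nrm x * nrm h.
Proof.
move=> rs x h.
rewrite -(@ler_pXn2r _ 2) ?nnegrE ?mulr_ge0 ?nrm_ge0 //.
have -> : nrm (ht T x h) ^+ 2 = complex.Re (ip (ht T x h) (ht T x h)).
  by rewrite ipxx.
rewrite ht_ip; apply: (le_trans (ler_norm _)); apply: (le_trans (Re_ip_le _ _)).
have := rep_contractive rs (rip x x) h; rewrite nrm_rip exprMn.
have := nrm_ge0 h; nra.
Qed.

Variables (K : hilbertType R).

Lemma ht_total_range : total_set (range (fun p : F * H => ht T p.1 p.2)).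
Proof.
have <- : [set z | exists x h, z = ht T x h]%classic =
    range (fun p : F * H => ht T p.1 p.2).
  apply/seteqP; split=> [_ [x [h ->]]|_ [[x h] _ <-]]; first by exists (x, h).
  by exists x, h.
exact: ht_total.
Qed.

(** Totality of elementary tensors leaves only one candidate, so the choice in [ht_lift] must return
    it. *)
Lemma ht_lift_unique (f : F -> H -> K) (S : T -> K) : bounded_op S ->
  (forall x h, S (ht T x h) = f x h) -> ht_lift f = S.
Proof.
move=> bS Sf; rewrite /ht_lift; case: xgetP => [S' _ [bS' S'f]|/(_ S)[]//].
apply: (bounded_op_ext ht_total_range) => // _ [[x h] _ <-] /=.
by rewrite Sf S'f.
Qed.

Lemma ht_lift_isometry (f : F -> H -> K) :
  (forall x1 x2 h1 h2, ip (f x1 h1) (f x2 h2) = ip h1 (sigma (rip x1 x2) h2)) ->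
  lin_isometry (ht_lift f : T -> K) /\
  forall x h, ht_lift f (ht T x h) = f x h.
Proof.
move=> hf; have [|S iS Sf] := @gram_isometry _ T K _
    (fun p => ht T p.1 p.2) (fun p => f p.1 p.2) _ ht_total_range.
  by move=> [x h] [y k]; rewrite ht_ip hf.
have Sf' x h : S (ht T x h) = f x h by exact: Sf (x, h).
by rewrite (ht_lift_unique (isometry_bounded iS) Sf').
Qed.

End HilbertModules.

Section IsometricCovariant.
Variables (R : realType) (A : cstarType R) (H : hilbertType R).
Variables (F : corrType A) (sigma : A -> H -> H) (V : F -> H -> H).
Hypotheses (cV : covariant_rep sigma V) (iV : isometric_rep sigma V).

Lemma isometric_rep_ip x y h k :
  ip (V x h) (V y k) = ip h (sigma (rip x y) k).
Proof. by rewrite (adjP (cov_bounded cV x)) iV. Qed.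

Variable T : htensor F sigma.

Lemma tilde_isometry : lin_isometry (tilde (T := T) V).
Proof. by have [] := ht_lift_isometry T isometric_rep_ip. Qed.

Lemma tildeE x h : tilde V (ht T x h) = V x h.
Proof. by have [_] := ht_lift_isometry T isometric_rep_ip; exact. Qed.

(** Covariance is assumed only in the two-sided form; the right half is read off the balanced tensor
    product. *)
Lemma cov_ract x a h : V (ract x a) h = V x (sigma a h).
Proof. by rewrite -!tildeE ht_balanced. Qed.

(** On vectors [sigma a k] this is the two-sided covariance, after moving [a] into the module; by
    nondegeneracy these vectors are total. *)
Lemma cov_lact b x h : V (lact b x) h = sigma b (V x h).
Proof.
have rs := cov_rep cV.
suff -> : V (lact b x) = sigma b \o V x by [].
apply: (bounded_op_ext (rep_nondegenerate rs)).
- exact: (cov_bounded cV).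
- by apply: bounded_op_comp; [exact: (rep_bounded rs) | exact: (cov_bounded cV)].
- by move=> _ [a [k ->]] /=; rewrite -cov_ract ract_lact (cov_covariant cV).
Qed.

End IsometricCovariant.

(** * The fringe operator *)

Section Density.
Variables (R : realType).

Lemma closure_lin (V : normedModType R[i]) (W : set V) c x y :
  (forall c x y, W x -> W y -> W (c *: x + y)) ->
  closure W x -> closure W y -> closure W (c *: x + y).
Proof.
move=> Wl /closureP hx /closureP hy; apply/closureP => e e0.
pose m := complex.Re `|c|.
have m0 : 0 <= m by rewrite -lecR /m RRe_real // normr_ge0.
have d0 : 0 < e / 2 / (m + 1) by rewrite !divr_gt0 // ltr_wpDl.
have [s Ws xs] := hx _ d0; have [t Wt yt] := hy _ (divr_gt0 e0 (ltr0Sn _ 1)).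
exists (c *: s + t); first exact: Wl.
rewrite opprD addrACA -scalerBr (le_lt_trans (nrmD _ _)) // nrmZC -/m [e]splitr.
apply: ler_ltD => //; move: xs; rewrite ltr_pdivlMr ?ltr_wpDl //.
have := nrm_ge0 (x - s); nra.
Qed.

Lemma total_image (V W : normedModType R[i]) (f : V -> W) (S : set V) (X : set W) :
  total_set S -> bounded_op f -> (forall s, S s -> X (f s)) ->
  forall x, closure (lspan X) (f x).
Proof.
move=> tS [lf cf] SX.
apply: (total_closed tS (W := [set x | closure (lspan X) (f x)]%classic)).
- by rewrite /= (lin0 lf); apply: subset_closure; exact: lspan0.
- by move=> c x y /= hx hy; rewrite lf; apply: closure_lin => // *; exact: lspan_lin.
- by apply: (continuous_closedP f).1 => //; exact: closed_closure.
- by move=> s /SX Xs; apply: subset_closure; exact: sub_lspan.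
Qed.

Lemma total_trans (V : normedModType R[i]) (S X : set V) :
  total_set S -> (forall s, S s -> closure (lspan X) s) -> total_set X.
Proof.
move=> tS SX; apply/seteqP; split=> // x _.
apply: (total_closed tS (W := closure (lspan X))) => //.
- by apply: subset_closure; exact: lspan0.
- by move=> c u v hu hv; apply: closure_lin => // *; exact: lspan_lin.
- exact: closed_closure.
Qed.

(** The closed range of [g] absorbs limits, so inclusion of ranges is tested on a total set only. *)
Lemma range_total (V W U : normedModType R[i]) (f : V -> W) (g : U -> W)
    (S : set V) :
  total_set S -> bounded_op f -> linear g -> closed (range g) ->
  (forall s, S s -> range g (f s)) -> forall x, range g (f x).
Proof.
move=> tS [lf cf] lg cg Sg.
apply: (total_closed tS (W := [set x | range g (f x)]%classic)) => //.
- by exists 0 => //; rewrite (lin0 lf) (lin0 lg).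
- by move=> c x y [u _ ux] [v _ vy]; exists (c *: u + v) => //; rewrite lg lf ux vy.
- by apply: (continuous_closedP f).1.
Qed.

Lemma isometry_comp (H K L : hilbertType R) (f : K -> L) (g : H -> K) :
  lin_isometry f -> lin_isometry g -> lin_isometry (f \o g).
Proof.
by move=> [lf nf] [lg ng]; split=> [c x y|x] /=; rewrite ?lg ?lf // nf ng.
Qed.

Variables (A : cstarType R) (H : hilbertType R) (sigma : A -> H -> H).
Hypothesis rs : representation sigma.

Lemma ht_bounded_r (F : corrType A) (T : htensor F sigma) x : bounded_op (ht T x).
Proof.
apply/bounded_opP; split; first exact: (ht_bilinear T).1.
exists (nrm x + 1) => [|h]; first by rewrite ltr_wpDl // nrm_ge0.
have := nrm_ht T rs x h; have := nrm_ge0 h; nra.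
Qed.

Lemma ht_bounded_l (F : corrType A) (T : htensor F sigma) h :
  bounded_op (fun x => ht T x h).
Proof.
apply/bounded_opP; split; first exact: (ht_bilinear T).2.
exists (nrm h + 1) => [|x]; first by rewrite ltr_wpDl // nrm_ge0.
have := nrm_ht T rs x h; have := nrm_ge0 x; nra.
Qed.

Section IdTens.
Variables (E F : corrType A) (EF : ctensor E F).
Variables (TEF : htensor EF sigma) (TF : htensor F sigma) (TE : htensor E sigma).

Let e (p : E * F * H) : TEF := ht TEF (ct EF p.1.1 p.1.2) p.2.

(** Elementary tensors are dense in the correspondence only up to linear span and limits; continuity
    of [ht TEF z h] in [z], hence contractivity, carries this over. *)
Lemma ht_ct_total : total_set (range e).
Proof.
apply: (total_trans (ht_total_range TEF)) => _ [[z h] _ <-] /=.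
apply: (total_image (ct_total EF) (ht_bounded_l TEF h)) => _ [x [y ->]].
by exists (x, y, h).
Qed.

(** The inner product in [E (x) F] contains [lact (rip x x')]; since [S] intertwines the left
    actions, this becomes [sigma (rip x x')] after [S], and the Gram matrices agree. *)
Lemma id_tens_isometry (S : TF -> H) : lin_isometry S ->
  (forall b y h, S (ht TF (lact b y) h) = sigma b (S (ht TF y h))) ->
  lin_isometry (id_tens TEF TE S) /\
  forall x y h, id_tens TEF TE S (ht TEF (ct EF x y) h) = ht TE x (S (ht TF y h)).
Proof.
move=> iS hS.
have [|Q iQ Qe] := @gram_isometry _ _ _ _ e
    (fun p => ht TE p.1.1 (S (ht TF p.1.2 p.2))) _ ht_ct_total.
  move=> [[x y] h] [[x' y'] h'] /=.
  by rewrite !ht_ip -hS (isometry_ip iS) ht_ip ct_rip.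
have Qe' x y h : Q (ht TEF (ct EF x y) h) = ht TE x (S (ht TF y h)).
  exact: Qe (x, y, h).
suff -> : id_tens TEF TE S = Q by [].
rewrite /id_tens; case: xgetP => [Q' _ [bQ' Q'e]|/(_ Q)[]]; last first.
  by split=> //; exact: isometry_bounded.
apply: (bounded_op_ext ht_ct_total bQ' (isometry_bounded iQ)).
by move=> _ [[[x y] h] _ <-]; rewrite Q'e Qe'.
Qed.

End IdTens.
End Density.

Section Fringe.
Variables (R : realType) (A : cstarType R) (E : product_system A).
Variables (H : hilbertType R) (sigma : A -> H -> H).
Variables (V1 : ps1 E -> H -> H) (V2 : ps2 E -> H -> H).
Variables (T : ps_htensor E sigma) (TW : htensor (ps2 E) (sigma2 T V1)).
Hypothesis iV : isometric_ps_rep T V1 V2.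

Let W1 := wandering1 T V1.
Let s2 := sigma2 T V1.
Let t1 : pt1 T -> H := tilde1 V1.
Let t2 : pt2 T -> H := tilde2 V2.
Let t12 : pt12 T -> H := tilde12 V1 V2.
Let c1 : covariant_rep sigma V1.
Proof. by have [[]] := iV. Qed.
Let c2 : covariant_rep sigma V2.
Proof. by have [[]] := iV. Qed.
Let i1 : isometric_rep sigma V1.
Proof. by have [_] := iV. Qed.
Let i2 : isometric_rep sigma V2.
Proof. by have [_ _] := iV. Qed.
Let rs : representation sigma := cov_rep c1.
Let it1 : lin_isometry t1 := tilde_isometry c1 i1 (pt1 T).
Let it2 : lin_isometry t2 := tilde_isometry c2 i2 (pt2 T).
Let t1E x h : t1 (ht (pt1 T) x h) = V1 x h := tildeE c1 i1 (pt1 T) x h.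
Let t2E x h : t2 (ht (pt2 T) x h) = V2 x h := tildeE c2 i2 (pt2 T) x h.

Lemma range_tilde1_invariant b z : range t1 (sigma b (t1 z)).
Proof.
apply: (range_total (f := sigma b \o t1) (ht_total_range (pt1 T))).
- by apply: bounded_op_comp (rep_bounded rs b) _; exact: isometry_bounded.
- exact: it1.1.
- exact: isometry_closed_range.
- move=> _ [[x h] _ <-] /=; rewrite t1E -(cov_lact c1 i1 (pt1 T)) -t1E.
  by eexists.
Qed.

Lemma proj_wandering1 h : val (proj W1 h) = h - t1 (adj t1 h).
Proof.
apply: proj_unique => [_ [z _ <-]|w Ww]; first exact: isometry_proj_ortho.
by rewrite opprB addrC subrK; apply: ipC0; apply: Ww; exists (adj t1 h).
Qed.

Lemma wandering1_split h : exists q, h = val (proj W1 h) + t1 q.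
Proof. by exists (adj t1 h); rewrite proj_wandering1 subrK. Qed.

Lemma proj_tilde1 z : proj W1 (t1 z) = 0.
Proof.
by apply: val_inj; rewrite proj_wandering1 (isometry_adjK it1) subrr.
Qed.

(** The range of [t1] is invariant under every [sigma b], in particular under the adjoint of
    [sigma a]. *)
Lemma wandering1_invariant a w : cs_set W1 w -> cs_set W1 (sigma a w).
Proof.
move=> Ww _ [z _ <-]; apply: ipC0; rewrite (rep_star rs); apply: ipC0.
by apply: Ww; exact: range_tilde1_invariant.
Qed.

(** [restrict_op] returns 0 outside the subspace; invariance excludes that case. *)
Lemma val_sigma2 a w : val (s2 a w) = sigma a (val w).
Proof.
rewrite /s2 /sigma2 /restrict_op insubdK //; apply: mem_set.
exact/wandering1_invariant/set_mem/(valP w).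
Qed.

Lemma proj_sigma a h : proj W1 (sigma a h) = s2 a (proj W1 h).
Proof.
have [q hq] := wandering1_split h; rewrite {1}hq (linD (rep_bounded rs a).1).
rewrite (linD (@proj_lin _ _ W1)); have [z _ <-] := range_tilde1_invariant a q.
by rewrite proj_tilde1 addr0 -val_sigma2 proj_id.
Qed.

Lemma val_bounded : bounded_op (val : cs_type W1 -> H).
Proof.
apply/bounded_opP; split; first by [].
by exists 1 => // w; rewrite mul1r nrm_val.
Qed.

Lemma proj_bounded : bounded_op (proj W1).
Proof.
apply/bounded_opP; split; first exact: proj_lin.
by exists 1 => // w; rewrite mul1r nrm_proj.
Qed.

Lemma sigma2_representation : representation s2.
Proof.
split.
- move=> a; have -> : s2 a = proj W1 \o (sigma a \o val).
    by apply/funext => w /=; rewrite proj_sigma proj_id.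
  apply: bounded_op_comp proj_bounded _.
  exact: bounded_op_comp (rep_bounded rs a) val_bounded.
- move=> w c a b; apply: val_inj; rewrite val_sigma2 (rep_linear rs) -!val_sigma2.
  by [].
- by move=> a b w; apply: val_inj; rewrite !val_sigma2 (rep_mul rs).
- move=> a v w; have := rep_star rs a (val v) (val w).
  by rewrite -!val_sigma2.
- apply/seteqP; split=> // w _; rewrite -(proj_id w).
  apply: (total_image (rep_nondegenerate rs) proj_bounded).
  by move=> _ [a [h ->]]; exists a, (proj W1 h); rewrite proj_sigma.
Qed.

Let iota : TW -> pt2 T := fringe_incl (TW := TW).

Let iota_spec : lin_isometry iota /\
  forall x w, iota (ht TW x w) = ht (pt2 T) x (val w).
Proof.
by apply: ht_lift_isometry => x1 x2 h1 h2; rewrite ht_ip -val_sigma2.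
Qed.

Let J : TW -> H := t2 \o iota.

Lemma fringe_isometry : lin_isometry J.
Proof. by apply: isometry_comp => //; exact: iota_spec.1. Qed.

Lemma fringe_repE x w : fringe_rep V2 TW x w = proj W1 (V2 x (val w)).
Proof. by rewrite /fringe_rep /fringe_op -/iota iota_spec.2 -/t2 t2E. Qed.

Lemma fringe_covariant : covariant_rep s2 (fringe_rep V2 TW).
Proof.
split.
- exact: sigma2_representation.
- move=> x; have -> : fringe_rep V2 TW x = proj W1 \o (V2 x \o val).
    by apply/funext => w; rewrite fringe_repE.
  apply: bounded_op_comp proj_bounded _.
  exact: bounded_op_comp (cov_bounded c2 x) val_bounded.
- by move=> w c x y; rewrite !fringe_repE (cov_linear c2) proj_lin.
(* The projection commutes with the inner sums and is contractive, so the constant of [V2] serves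
   unchanged. *)
- have [c c0 hc] := cov_cb c2; exists c => // n x r r0 xr h.
  apply: le_trans (hc n x r r0 xr (fun l => val (h l))).
  apply: ler_sum => k _; under eq_bigr do rewrite fringe_repE.
  rewrite -(lin_sum (@proj_lin _ _ W1)) ler_pXn2r ?nnegrE ?normr_ge0 //.
  by rewrite !nrmE lecR nrm_proj.
- move=> b x a w; rewrite !fringe_repE (cov_covariant c2) proj_sigma.
  by rewrite val_sigma2.
Qed.

(** [fringe_rep] is read off [fringe_op] at elementary tensors, and [fringe_op] is bounded as a
    projection after an isometry. This connects the representation with the abstract operator
    [G]. *)
Lemma tilde_fringe : tilde (fringe_rep V2 TW) = fringe_op V2 TW.
Proof.
apply: ht_lift_unique => //.
exact: (proj_isometry_bounded W1 fringe_isometry).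
Qed.

Let U : pt21 T -> pt2 T := id_tens (pt21 T) (pt2 T) t1.

Let U_spec : lin_isometry U /\ forall x y h,
  U (ht (pt21 T) (ct (ps21 E) x y) h) = ht (pt2 T) x (t1 (ht (pt1 T) y h)).
Proof.
apply: id_tens_isometry => // b y h.
by rewrite !t1E (cov_lact c1 i1 (pt1 T)).
Qed.

Let M : pt12 T -> pt21 T := tens_id (pt12 T) (pt21 T) (@Defs.t12 _ _ E).

Let M_spec : lin_isometry M /\
  forall x h, M (ht (pt12 T) x h) = ht (pt21 T) (Defs.t12 x) h.
Proof.
apply: ht_lift_isometry => x1 x2 h1 h2.
by rewrite ht_ip -(cu_rip (t21_unitary E)) !t12K.
Qed.

Let M_surj u : exists z, M z = u.
Proof.
have [||z _ <-] := range_total (f := id) (g := M) (ht_total_range (pt21 T)) _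
  M_spec.1.1 (isometry_closed_range M_spec.1) _ u.
- by split=> // x; exact: cvg_id.
- move=> _ [[x h] _ <-] /=; exists (ht (pt12 T) (t21 x) h) => //.
  by rewrite M_spec.2 t21K.
- by exists z.
Qed.

Let t12E z : t12 z = t2 (U (M z)).
Proof. by rewrite /t12; have [[_ _ ->] _ _] := iV. Qed.

(** The commutation relation puts [t2] outermost, which also places the range of the product
    isometry inside that of [t2]. *)
Lemma tilde12_isometry : lin_isometry t12.
Proof.
have -> : t12 = t2 \o (U \o M) by apply/funext => z; rewrite t12E.
by do 2![apply: isometry_comp => //]; [exact: U_spec.1 | exact: M_spec.1].
Qed.

(** Clear for [q] an elementary tensor; the closed range of [U] covers the rest. *)
Lemma ht_tilde1_range x q : range U (ht (pt2 T) x (t1 q)).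
Proof.
apply: (range_total (f := ht (pt2 T) x \o t1) (ht_total_range (pt1 T))).
- by apply: bounded_op_comp (ht_bounded_r rs _ x) _; exact: isometry_bounded.
- exact: U_spec.1.1.
- exact: isometry_closed_range U_spec.1.
- move=> _ [[y h] _ <-] /=; exists (ht (pt21 T) (ct (ps21 E) x y) h) => //.
  by rewrite U_spec.2.
Qed.

(** On elementary tensors the inner product is that of [w] with [V1 (lact (rip x' x) y) h], which
    vanishes as [w] is orthogonal to the range of [t1]. Passing to adjoints twice reduces to this
    case. *)
Lemma fringe_incl_ortho a u : ip (iota a) (U u) = 0.
Proof.
have bU := isometry_bounded U_spec.1; have bi := isometry_bounded iota_spec.1.
apply: ipC0; rewrite (adjP bU).
suff -> : adj U (iota a) = 0 by rewrite ip0r.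
apply: (ortho_total (ht_ct_total rs (pt21 T))) => _ [[[x y] h] _ <-] /=.
rewrite -(adjP bU) U_spec.2 t1E; apply: ipC0; rewrite (adjP bi).
suff -> : adj iota (ht (pt2 T) x (V1 y h)) = 0 by rewrite ip0r.
apply: (ortho_total (ht_total_range TW)) => _ [[x' w] _ <-] /=.
rewrite -(adjP bi) iota_spec.2 ht_ip -(cov_lact c1 i1 (pt1 T)) -t1E.
by apply: ipC0; apply: (set_mem (valP w)); eexists.
Qed.

(* E_2 (x) H splits as (E_2 (x) W_1) + (E_2 (x) V_1(E_1 (x) H)), which V_2
   maps to the ranges of J and of the product isometry. *)
Lemma tilde2_split h : t2 (adj t2 h) = J (adj J h) + t12 (adj t12 h).
Proof.
set r := J (adj J h); set s := t12 (adj t12 h).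
have Js a b : ip (J a) (t12 b) = 0.
  by rewrite t12E (isometry_ip it2) fringe_incl_ortho.
apply: (isometry_projE it2).
  exists (iota (adj J h) + U (M (adj t12 h))) => //.
  by rewrite (linD it2.1) -t12E.
have bt2 := isometry_bounded it2.
(* It is enough to test against [t2] of elementary tensors; splitting the second leg along [W1]
   writes each of these as a vector in the range of [J] plus one in the range of [t12]. *)
suff h0 : adj t2 (h - (r + s)) = 0 by move=> z; rewrite (adjP bt2) h0 ip0r.
apply: (ortho_total (ht_total_range (pt2 T))) => _ [[x k] _ <-] /=.
have [q ->] := wandering1_split k.
rewrite -(adjP bt2) (linD ((ht_bilinear (pt2 T)).1 x)) (linD it2.1) ipDl.
have [u _ <-] := ht_tilde1_range x q; have [v <-] := M_surj u.
rewrite -t12E -iota_spec.2 -[t2 (iota _)]/(J _).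
have -> : ip (J (ht TW x (proj W1 k))) (h - (r + s)) = 0.
  by rewrite opprD addrA ipBr (isometry_proj_ortho fringe_isometry) /s Js subrr.
rewrite [r + s]addrC opprD addrA ipBr (isometry_proj_ortho tilde12_isometry).
by rewrite /r (ipC0 (Js _ _)) subrr addr0.
Qed.

Lemma joint_defectE h :
  joint_defect T V1 V2 h = val (proj W1 h) - J (adj J h).
Proof.
rewrite /joint_defect -/t1 -/t2 -/t12 proj_wandering1 tilde2_split.
by rewrite opprD addrA addrNK.
Qed.

End Fringe.

Theorem theorem5p5 (R : realType) (A : cstarType R) (E : product_system A)
    (H : hilbertType R) (sigma : A -> H -> H)
    (V1 : ps1 E -> H -> H) (V2 : ps2 E -> H -> H)
    (T : ps_htensor E sigma) (TW : htensor (ps2 E) (sigma2 T V1)) :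
  isometric_ps_rep T V1 V2 ->
  compact_op (joint_defect T V1 V2) ->
  fredholm_rep TW (fringe_rep V2 TW) /\
  rep_index TW (fringe_rep V2 TW) =
    (dimension (op_eigenspace (joint_defect T V1 V2) (-1)))%:Z -
    (dimension (op_eigenspace (joint_defect T V1 V2) 1))%:Z.
Proof.
move=> iV cC.
have iJ := fringe_isometry TW iV; have CE := joint_defectE TW iV.
rewrite /fredholm_rep /rep_index tilde_fringe //.
split; first split.
- exact: fringe_covariant.
- exact: proj_isometry_fredholm iJ CE cC.
- exact: proj_isometry_index iJ CE.
Qed.
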